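(* Let $q$ be a square-free positive integer and let $\mathcal{D}=\{h_1,h_2,\dots,h_s\}$ be a fixed admissible set of integers. Let $a_1<a_2<\cdots$ be, in increasing order, the positive integers $a$ for which $a+h_1,\dots,a+h_s$ is an $s$-tuple of reduced residues modulo $q$. Then for $\lambda>0$, $$V^{\mathcal{D}}_{\lambda}(q):=\sum_{i=1}^{\phi_{\mathcal{D}}(q)}(a_{i+1}-a_i)^{\lambda}\ll \phi_{\mathcal{D}}(q)\,P^{-s\lambda},$$ where $\phi_{\mathcal{D}}(q)=\prod_{p\mid q}(p-\nu_p(\mathcal{D}))$, $P=\phi(q)/q$, and the implied constant depends only on $\mathcal{D}$ and $\lambda$.
   Context: For a finite set of integers $\mathcal{D}$ and a prime $p$, $\nu_p(\mathcal{D})$ denotes the number of distinct residues modulo $p$ of the elements of $\mathcal{D}$. $\mathcal{D}$ is admissible if $\nu_p(\mathcal{D})<p$ for every prime $p$. The integers $a+h_1,\dots,a+h_s$ form an $s$-tuple of reduced residues modulo $q$ if each $a+h_j$ is coprime to $q$. $\phi$ is Euler's function. *)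

(* Defs.v *)
From mathcomp Require Import all_boot all_order all_algebra.
From mathcomp Require Import finmap.
From mathcomp Require Import reals exp.

Set Implicit Arguments.
Unset Strict Implicit.
Unset Printing Implicit Defensive.

Import Order.TTheory GRing.Theory Num.Theory.

Local Open Scope ring_scope.
Local Open Scope fset_scope.

Definition squarefree (q : nat) : Prop :=
  forall d : nat, (d ^ 2 %| q)%N -> d = 1%N.

Definition nu (p : nat) (D : {fset int}) : nat :=
  #|` [fset (h %% p%:Z)%Z | h in D]|.

Definition admissible (D : {fset int}) : Prop :=
  forall p : nat, prime p -> (nu p D < p)%N.

(* The subtraction is on nat; it does not truncate, since nu p D <= p. *)
Definition phiD (D : {fset int}) (q : nat) : nat :=
  (\prod_(p <- primes q) (p - nu p D))%N.

Definition reduced_tuple (D : {fset int}) (q a : nat) : Prop :=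
  forall h : int, h \in D -> coprimez (a%:Z + h) q%:Z.

(* a 1 < a 2 < ... is the sequence of all positive integers satisfying A;
   indices start at 1 and the value a 0 is irrelevant. *)
Definition increasing_enumeration (A : nat -> Prop) (a : nat -> nat) : Prop :=
  (forall i j : nat, (0 < i)%N -> (i < j)%N -> (a i < a j)%N) /\
  (forall n : nat,
     ((0 < n)%N /\ A n) <-> (exists2 i : nat, (0 < i)%N & a i = n)).

Definition gap_moment (R : realType) (a : nat -> nat) (lambda : R) (N : nat) : R :=
  \sum_(1 <= i < N.+1) ((a i.+1)%:R - (a i)%:R) `^ lambda.

(* Main.v *)
Require Import Defs.
From mathcomp Require Import all_boot all_order all_algebra.
From mathcomp Require Import finmap.
From mathcomp Require Import reals exp.
From mathcomp Require Import sequences.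
From mathcomp Require Import zify ring lra.

Set Implicit Arguments.
Unset Strict Implicit.
Unset Printing Implicit Defensive.

Import Order.TTheory GRing.Theory Num.Theory.

Local Open Scope ring_scope.
Local Open Scope fset_scope.

(** The gap moments are controlled by the number G(h) of residues n mod q for which
    the window n, ..., n + h - 1 contains no admissible a, so it suffices to show
    G(h) << q (1 + h rho)^(-k) for every k, where rho = prod_(p | q) (1 - nu_p / p) is
    at least a constant times P^s.

    The residues of n modulo the primes p | q are independent. Sift the window by
    the primes in increasing order. A window longer than twice the product of the primes
    below z = 2^J contains at least half the expected number of survivors; this allows
    z comparable to log h, by Chebyshev's bound for the primorial. For the primes
    p >= z, the number of points killed by p has conditional mean nu_p / p times the
    number of survivors and is bounded by K_p; averaging over n mod p therefore turns
    exp (- t * survivors) into at most exp (- t' * survivors) with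
    t' = t (1 - (nu_p / p) (1 + M t K_p)). Running through the primes downwards
    leaves the exponent h / (2 w), where w is at most a constant times
    1 / rho + eps * h / log h, with eps arbitrarily small. Since exp (- h / (2 w))
    bounds G(h) / q, this beats every power of 1 + h rho. *)

(** * Survivors of the sieve *)

Section Sums.
Local Open Scope nat_scope.

(** Reindexing by the Chinese remainder bijection. The operation is left abstract because both
    counts in [nat] and exponential sums in a real field are split this way. *)
Lemma big_crt (T : Type) (idx : T) (op : Monoid.com_law idx) (m n : nat)
    (f : nat -> nat -> T) :
  coprime m n -> 0 < m -> 0 < n ->
  \big[op/idx]_(a < m * n) f (a %% m) (a %% n) =
  \big[op/idx]_(a < m) \big[op/idx]_(b < n) f a b.
Proof.
move=> cop m0 n0; have mn0 : 0 < m * n by rewrite muln_gt0 m0.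
pose F (p : 'I_m * 'I_n) := Ordinal (ltn_pmod (chinese m n p.1 p.2) mn0).
pose G (a : 'I_(m * n)) := (Ordinal (ltn_pmod a m0), Ordinal (ltn_pmod a n0)).
have FG : cancel G F.
  by move=> a; apply: val_inj; rewrite /= -(chinese_mod cop a) modn_small.
have GF : cancel F G.
  move=> [a b]; congr pair; apply: val_inj => /=.
    by rewrite modn_dvdm ?dvdn_mulr// chinese_modl// modn_small.
  by rewrite modn_dvdm ?dvdn_mull// chinese_modr// modn_small.
rewrite pair_bigA /= [RHS](reindex G) //.
by exists F => x _; [exact: FG | exact: GF].
Qed.

Lemma big_periodic_shift (T : Type) (idx : T) (op : Monoid.com_law idx)
    (q n : nat) (f : nat -> T) :
  (forall a, f (a + q) = f a) ->
  \big[op/idx]_(n <= a < n + q) f a = \big[op/idx]_(a < q) f a.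
Proof.
move=> fq; elim: n => [|n IH]; first by rewrite add0n big_mkord.
rewrite -IH; case: q fq {IH} => [|q] fq; first by rewrite !addn0 !big_geq.
rewrite [RHS]big_ltn ?addnS ?ltnS ?leq_addr// addSn big_nat_recr ?ltnS ?leq_addr//=.
by rewrite -addnS fq Monoid.mulmC.
Qed.

Lemma sumn_periodic_mul (q k : nat) (f : nat -> nat) :
  (forall a, f (a + q) = f a) ->
  \sum_(a < k * q) f a = k * \sum_(a < q) f a.
Proof.
move=> fq; rewrite -(big_mkord xpredT); elim: k => [|k IH]; first by rewrite big_geq.
rewrite (@big_cat_nat _ _ _ (k * q)) ?leq_mul//= IH mulSn addnC mulSn.
by rewrite [q + _]addnC big_periodic_shift.
Qed.

Lemma leq_sum_ord (m n : nat) (f : nat -> nat) :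
  m <= n -> \sum_(a < m) f a <= \sum_(a < n) f a.
Proof.
move=> mn; rewrite -!(big_mkord xpredT) [X in _ <= X](@big_cat_nat _ _ _ m)//=.
exact: leq_addr.
Qed.

End Sums.

Section Admissible.
Local Open Scope nat_scope.
Variable D : {fset int}.

Definition good (q a : nat) : bool :=
  all (fun h : int => coprimez (a%:Z + h)%R q%:Z) D.

Definition survivors (q n h : nat) : nat := \sum_(m < h) good q (n + m).

Lemma goodP q a : reflect (reduced_tuple D q a) (good q a).
Proof. exact: allP. Qed.

Lemma good1 a : good 1 a.
Proof. by apply/allP => h _; rewrite coprimezE coprimen1. Qed.

Lemma goodM q1 q2 a : good (q1 * q2) a = good q1 a && good q2 a.
Proof.
by rewrite /good -all_predI; apply: eq_all => h /=; rewrite PoszM coprimezMr.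
Qed.

Lemma good_dvd q1 q2 a : q1 %| q2 -> good q2 a -> good q1 a.
Proof. by move=> /dvdnP[k ->]; rewrite goodM => /andP[]. Qed.

Lemma good_mod q a b : a = b %[mod q] -> good q a = good q b.
Proof.
move=> ab; apply: eq_all => h; rewrite !/(coprimez _ q) ![gcdz _ q]gcdzC.
rewrite -gcdz_modr -[in RHS]gcdz_modr; congr (gcdz _ _ == _).
by rewrite -[LHS]modzDml -[RHS]modzDml !modz_nat ab.
Qed.

Lemma good_period q a : good q (a + q) = good q a.
Proof. by apply: good_mod; rewrite modnDr. Qed.

Lemma good_prime p a : prime p ->
  good p a = ~~ has (fun h : int => (p%:Z %| (a%:Z + h)%R)%Z) D.
Proof.
move=> pp; rewrite -all_predC; apply: eq_all => h /=.
by rewrite coprimez_sym coprimezE prime_coprime.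
Qed.

Lemma nu_le_card p : nu p D <= #|` D|.
Proof. exact: leq_imfset_card. Qed.

(** A residue [r] fails exactly when [r] is [- h] mod [p] for some [h] in [D], so [r |-> - r] maps
    the failing residues bijectively onto the residues that [nu] counts. The shift by [n] is
    harmless by periodicity. *)
Lemma sum_not_good_prime p n : prime p -> \sum_(r < p) ~~ good p (n + r) = nu p D.
Proof.
move=> pp; have p0 := prime_gt0 pp.
have -> : \sum_(r < p) ~~ good p (n + r) = \sum_(r < p) ~~ good p r.
  rewrite -(@big_periodic_shift _ _ addn p n (fun r => ~~ good p r)); last first.
    by move=> a; rewrite good_period.
  rewrite -[X in \sum_(X <= _ < _) _]add0n big_addn addKn big_mkord.
  by apply: eq_bigr => i _; rewrite addnC.
pose f (r : 'I_p) : int := ((- (r%:Z))%R %% p%:Z)%Z.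
have f_inj : injective f.
  move=> r t; rewrite /f => rt; apply: val_inj => /=.
  have := congr1 (fun x => ((- x)%R %% p%:Z)%Z) rt.
  by rewrite !modzNm !opprK !modz_nat !modn_small// => -[].
transitivity (size [seq f r | r : 'I_p <- enum 'I_p & ~~ good p r]).
  rewrite size_map size_filter -sum1_count big_enum_cond [RHS]big_mkcond /=.
  by apply: eq_bigr => r _; case: good.
apply/perm_size/uniq_perm => [||x].
- by rewrite map_inj_uniq// filter_uniq// enum_uniq.
- exact: fset_uniq.
apply/mapP/imfsetP => /= [[r rin ->]|[h hD ->]].
  move: rin; rewrite mem_filter good_prime// negbK => /andP[/hasP[h hD pr] _].
  by exists h => //; apply/eqP; rewrite eqz_mod_dvd -opprD dvdzE abszN.
have pz : p%:Z != 0%R by rewrite eqz_nat -lt0n.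
have := modz_ge0 (- h)%R pz; have := ltz_pmod (- h)%R (p0 : (0 < p%:Z)%R).
case E : ((- h)%R %% p)%Z => [t|//]; rewrite ltz_nat => tp _.
exists (Ordinal tp) => /=.
  rewrite mem_filter mem_enum andbT good_prime// negbK; apply/hasP; exists h => //=.
  by apply/dvdz_mod0P; rewrite -E modzDml addNr mod0z.
by rewrite /f /= -E modzNm opprK.
Qed.

Lemma sum_good_shift q n : \sum_(a < q) good q (n + a) = \sum_(a < q) good q a.
Proof.
rewrite -(@big_periodic_shift _ _ addn q n (fun a => good q a)); last first.
  by move=> a; rewrite good_period.
rewrite -[X in \sum_(X <= _ < _) _]add0n big_addn addKn big_mkord.
by apply: eq_bigr => i _; rewrite addnC.
Qed.

Lemma sum_goodM q1 q2 : coprime q1 q2 -> 0 < q1 -> 0 < q2 ->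
  \sum_(a < q1 * q2) good (q1 * q2) a =
  (\sum_(a < q1) good q1 a) * (\sum_(a < q2) good q2 a).
Proof.
move=> cop q10 q20; rewrite big_distrl /=.
under [RHS]eq_bigr do rewrite big_distrr /=.
rewrite -(@big_crt _ _ addn q1 q2 (fun a b => good q1 a * good q2 b))//.
apply: eq_bigr => a _; rewrite goodM mulnb.
by rewrite (good_mod (modn_mod a q1)) (good_mod (modn_mod a q2)).
Qed.

Lemma sum_good_prime p : prime p -> \sum_(a < p) good p a = p - nu p D.
Proof.
move=> pp; rewrite -(sum_not_good_prime 0 pp).
apply: (@addIn (\sum_(r < p) ~~ good p (0 + r))).
rewrite subnK; last first.
  rewrite -[leqRHS]card_ord -sum1_card; apply: leq_sum => i _.
  by case: good.
rewrite -big_split /= -[RHS]card_ord -sum1_card; apply: eq_bigr => i _.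
by case: good.
Qed.

Section Window.
Variables (Q p : nat) (cop : coprime Q p) (Q0 : 0 < Q) (pp : prime p).
Let p0 := prime_gt0 pp.

(** The points that survive [Q] and are killed by [p]. The start of the window is recorded
    separately as [n] mod [Q] and [r] mod [p], so that [r] can be averaged with [n] fixed. *)
Let hit n r m : nat := good Q (n + m) && ~~ good p (r + m).

Let hit_period n r m : hit n r (m + Q * p) = hit n r m.
Proof.
rewrite /hit !addnA; congr (nat_of_bool (_ && ~~ _)); apply: good_mod.
  by rewrite -modnDmr modnMr addn0.
by rewrite -modnDmr modnMl addn0.
Qed.

Lemma sum_hit_period n r :
  \sum_(m < Q * p) hit n r m = (\sum_(a < Q) good Q a) * nu p D.
Proof.
rewrite -(sum_not_good_prime r pp) -(sum_good_shift Q n) big_distrl /=.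
under [RHS]eq_bigr do rewrite big_distrr /=.
rewrite -(@big_crt _ _ addn Q p (fun a b => good Q (n + a) * ~~ good p (r + b)))//.
apply: eq_bigr => m _; rewrite /hit mulnb.
by congr (nat_of_bool (_ && ~~ _)); apply: good_mod; rewrite modnDmr.
Qed.

(** The window is covered by [h %/ (Q * p) + 1] periods, which is at most [2 * h / (Q * p)]. *)
Lemma sum_hit_le n r h : Q * p <= h ->
  (Q * p) * (\sum_(m < h) hit n r m) <=
  2 * h * ((\sum_(a < Q) good Q a) * nu p D).
Proof.
move=> Qph; have Qp0 : 0 < Q * p by rewrite muln_gt0 Q0.
rewrite -(sum_hit_period n r).
have le1 : \sum_(m < h) hit n r m <=
    (h %/ (Q * p)).+1 * \sum_(m < Q * p) hit n r m.
  rewrite -sumn_periodic_mul; last exact: hit_period.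
  by rewrite leq_sum_ord// ltnW// ltn_ceil.
apply: leq_trans (leq_mul (leqnn _) le1) _.
rewrite mulnA leq_mul2r; apply/orP; right.
rewrite mulnS addnC mulnC mul2n -addnn leq_add//.
exact: leq_trunc_div.
Qed.

(** Forgets the condition modulo [Q]; meant for windows shorter than one period [Q * p]. *)
Lemma sum_hit_trivial n r h : \sum_(m < h) hit n r m <= (h %/ p).+1 * nu p D.
Proof.
apply: (@leq_trans (\sum_(m < h) ~~ good p (r + m))).
  by apply: leq_sum => m _; rewrite /hit; case: good.
rewrite -(sum_not_good_prime r pp).
rewrite -(@sumn_periodic_mul p _ (fun m => ~~ good p (r + m))); last first.
  by move=> a; rewrite addnA good_period.
by apply: (@leq_sum_ord _ _ (fun m => ~~ good p (r + m))); rewrite ltnW// ltn_ceil.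
Qed.

End Window.

(** The whole periods inside the window fill at least half of its length. *)
Lemma survivors_ge Q n h : 0 < Q -> 2 * Q <= h ->
  h * (\sum_(a < Q) good Q a) <= 2 * Q * survivors Q n h.
Proof.
move=> Q0 Qh; rewrite -(sum_good_shift Q n).
apply: (@leq_trans (2 * Q * ((h %/ Q) * \sum_(a < Q) good Q (n + a)))); last first.
  rewrite leq_mul2l; apply/orP; right.
  rewrite -(@sumn_periodic_mul Q _ (fun m => good Q (n + m))); last first.
    by move=> a; rewrite addnA good_period.
  by apply: (@leq_sum_ord _ _ (fun m => good Q (n + m))); exact: leq_trunc_div.
rewrite mulnA leq_mul2r; apply/orP; right.
have : 2 <= h %/ Q by rewrite leq_divRL.
have := ltn_ceil h Q0; nia.
Qed.

End Admissible.

(** * Averaging over one prime *)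

Section Laplace.
Local Open Scope ring_scope.
Variable R : realType.

(** From [1 - x <= expR (- x)] one gets [expR x * (1 - x) <= 1], hence
    [expR x * (1 - x ^+ 2) <= 1 + x]; the leftover [expR x * x ^+ 2] is bounded by monotonicity. *)
Lemma expR_le_quadratic (x X : R) :
  0 <= x -> x <= X -> expR x <= 1 + x + expR X * x ^+ 2.
Proof.
move=> x0 xX.
have h : expR x * (1 - x ^+ 2) <= 1 + x.
  have -> : 1 - x ^+ 2 = (1 + x) * (1 - x) by ring.
  have := expR_ge1Dx (- x); rewrite expRN => e.
  have e' : expR x * (1 - x) <= 1.
    by rewrite mulrC -ler_pdivlMr ?expR_gt0// mul1r.
  have -> : expR x * ((1 + x) * (1 - x)) = (1 + x) * (expR x * (1 - x)) by ring.
  by rewrite -[leRHS]mulr1 ler_wpM2l// addr_ge0.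
have : expR x * x ^+ 2 <= expR X * x ^+ 2 by rewrite ler_wpM2r ?sqr_ge0// ler_expR.
lra.
Qed.

Variables (D : {fset int}) (Q p h : nat).
Hypotheses (cop : coprime Q p) (Q0 : (0 < Q)%N) (pp : prime p).

(* For 0 <= c <= K one has c ^ 2 <= K * c, so the quadratic bound on [expR (t * c)]
   becomes affine in the number c of points killed, whose mean over the residues
   mod p is exactly nu_p / p times the number of survivors. *)
Lemma laplace_step (t K X : R) : 0 <= t -> 0 <= K -> t * K <= X ->
  (forall n r : nat,
     (\sum_(m < h) (good D Q (n + m) && ~~ good D p (r + m)))%:R <= K) ->
  \sum_(n < Q * p) expR (- (t * (survivors D (Q * p) n h)%:R)) <=
  p%:R * \sum_(n < Q)
    expR (- (t * (1 - (nu p D)%:R / p%:R * (1 + expR X * (t * K)))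
              * (survivors D Q n h)%:R)).
Proof.
move=> t0 K0 tKX hitK; have p0 := prime_gt0 pp.
pose hit n r := (\sum_(m < h) (good D Q (n + m) && ~~ good D p (r + m)))%N.
(* Written this way, the summand depends on [n] only through its residues mod [Q] and mod [p], as
   [big_crt] requires. *)
have survE n : survivors D (Q * p) n h =
    (survivors D Q (n %% Q) h - hit (n %% Q) (n %% p))%N.
  have E : (survivors D (Q * p) n h + hit (n %% Q) (n %% p)
            = survivors D Q (n %% Q) h)%N.
    rewrite /hit /survivors -big_split /=; apply: eq_bigr => m _.
    rewrite goodM (@good_mod D Q (n %% Q + m) (n + m)) ?modnDml//.
    rewrite (@good_mod D p (n %% p + m) (n + m)) ?modnDml//.
    by case: (good D Q (n + m)); case: (good D p (n + m)).
  by rewrite -E addnK.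
have hit_le n r : (hit n r <= survivors D Q n h)%N.
  rewrite /hit /survivors; apply: leq_sum => m _.
  by case: (good D Q (n + m)); rewrite ?leq_b1.
under eq_bigr do rewrite survE.
rewrite (@big_crt _ _ +%R Q p
  (fun a b => expR (- (t * (survivors D Q a h - hit a b)%N%:R))))//.
rewrite mulr_sumr; apply: ler_sum => n _.
set S := survivors D Q n h.
(* Each point surviving [Q] is killed for exactly [nu p D] values of [r]. *)
have sum_hit : (\sum_(r < p) hit n r = S * nu p D)%N.
  rewrite exchange_big /= big_distrl /=; apply: eq_bigr => m _.
  case: (good D Q (n + m)) => /=; last by rewrite mul0n big1.
  rewrite mul1n -(sum_not_good_prime D m pp).
  by apply: eq_bigr => r _; rewrite addnC.
have quad (r : 'I_p) : expR (- (t * (S - hit n r)%N%:R)) <=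
    expR (- (t * S%:R)) * (1 + t * (1 + expR X * (t * K)) * (hit n r)%:R).
  rewrite natrB//.
  have -> : - (t * (S%:R - (hit n r)%:R)) = - (t * S%:R) + t * (hit n r)%:R by ring.
  rewrite expRD ler_pM2l ?expR_gt0//.
  have tc : t * (hit n r)%:R <= t * K by rewrite ler_wpM2l //; exact: hitK.
  have tc0 : 0 <= t * (hit n r)%:R by rewrite mulr_ge0.
  apply: le_trans (expR_le_quadratic tc0 (le_trans tc tKX)) _.
  have : (t * (hit n r)%:R) ^+ 2 <= (t * (hit n r)%:R) * (t * K).
    by rewrite expr2 ler_wpM2l.
  rewrite -(@ler_pM2l _ (expR X)) ?expR_gt0//; lra.
apply: le_trans (ler_sum _ (fun r _ => quad r)) _.
rewrite -mulr_sumr big_split /= sumr_const card_ord -mulr_sumr -natr_sum sum_hit.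
(* The average over [r] is now affine in [S]; [1 + y <= expR y] makes it an exponential again. *)
set c := 1 + expR X * (t * K).
have -> : - (t * (1 - (nu p D)%:R / p%:R * c) * S%:R) =
  - (t * S%:R) + t * c * (S * nu p D)%:R / p%:R by rewrite natrM; ring.
rewrite expRD mulrCA ler_pM2l ?expR_gt0//.
have p0R : (0 : R) < p%:R by rewrite ltr0n.
have -> : 1 *+ p + t * c * (S * nu p D)%:R =
  p%:R * (1 + t * c * (S * nu p D)%:R / p%:R).
  by field; rewrite lt0r_neq0.
by rewrite ler_pM2l// expR_ge1Dx.
Qed.

End Laplace.

(** * Chebyshev bounds *)

Section Chebyshev.
Local Open Scope nat_scope.

Lemma coprime_prod_lt (P : pred nat) (m y : nat) :
  (forall p, P p -> prime p) -> prime y ->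
  coprime (\prod_(m <= p < y | P p) p) y.
Proof.
move=> Pp py; rewrite big_nat_cond.
apply: (big_ind (fun x => coprime x y)) => [|a b ca cb|p /andP[/andP[_ lt_py] /Pp pp]].
- exact: coprime1n.
- by rewrite coprimeMl ca.
- by rewrite prime_coprime// dvdn_prime2// ltn_eqF.
Qed.

Lemma prod_primes_dvd (P : pred nat) (m n N : nat) :
  (forall p, P p -> prime p) ->
  (forall p, m <= p < n -> P p -> p %| N) -> \prod_(m <= p < n | P p) p %| N.
Proof.
move=> Pp; elim: n => [|n IH] dN; first by rewrite big_geq.
have [nm|mn] := ltnP n m; first by rewrite big_geq.
have dvd_n : \prod_(m <= p < n | P p) p %| N.
  by apply: IH => p /andP[mp pn]; apply: dN; rewrite mp ltnW.
rewrite big_mkcond big_nat_recr//= -big_mkcond /=.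
case: ifP => [Pn|_]; last by rewrite muln1.
by rewrite Gauss_dvd ?coprime_prod_lt ?Pp// dvd_n dN// mn ltnSn.
Qed.

Lemma bin_leq_exp2 n k : k <= n -> 'C(n, k) <= 2 ^ n.
Proof.
move=> kn; rewrite -[2]/(1 + 1) expnDn.
under eq_bigr do rewrite !exp1n !muln1.
by rewrite (bigD1 (Ordinal (kn : k < n.+1)))//= leq_addr.
Qed.

Lemma prime_ndvd_fact p n : prime p -> n < p -> ~~ (p %| n`!).
Proof.
move=> pp; elim: n => [|n IH] np; first by rewrite dvdn1 eqn_leq leqNgt prime_gt1.
by rewrite factS Euclid_dvdM// negb_or IH 1?ltnW// andbT gtnNdvd.
Qed.

(** Each prime in the range divides ['C(n.*2, n)], as it divides the factorial of [n.*2] but not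
    that of [n]. *)
Lemma prod_primes_double n :
  \prod_(n.+1 <= p < n.*2.+1 | prime p) p <= 2 ^ n.*2.
Proof.
have nn : n <= n.*2 by rewrite -addnn leq_addr.
apply: leq_trans (bin_leq_exp2 nn); apply: dvdn_leq; first by rewrite bin_gt0.
apply: prod_primes_dvd => // p /andP[np pn] pp.
have : p %| n.*2`! by rewrite dvdn_fact// prime_gt0//= -ltnS.
rewrite -(bin_fact nn) -[X in (X - n)`!]addnn addnK !Euclid_dvdM//.
by rewrite (negPf (prime_ndvd_fact pp np)) !orbF.
Qed.

(** Moves the range of [prod_primes_double] by one: [2 ^ j] is not prime for [j > 1], and a possible
    factor at the upper end is at least 1. *)
Lemma prod_primes_dyadic j : 1 < j ->
  \prod_(2 ^ j <= p < 2 ^ j.+1 | prime p) p <= 2 ^ 2 ^ j.+1.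
Proof.
move=> j1; have := prod_primes_double (2 ^ j); rewrite -mul2n -expnS.
apply: leq_trans; rewrite big_ltn_cond ?ltn_exp2l//.
have /negPf -> : ~~ prime (2 ^ j).
  apply/negP => /even_prime[/eqP|]; last by rewrite oddX; case: j j1.
  by rewrite -[X in _ == X]expn1 eqn_exp2l// => /eqP j2; rewrite j2 in j1.
rewrite [leqRHS]big_mkcond big_nat_recr ?ltn_exp2l//= -big_mkcond /= leq_pmulr//.
by case: ifP => // /prime_gt0.
Qed.

(** Every prime of the block is at least [2 ^ j]; compare the exponents of 2 in the bound for their
    product. *)
Lemma count_primes_dyadic j : 1 < j ->
  j * \sum_(2 ^ j <= p < 2 ^ j.+1 | prime p) 1 <= 2 ^ j.+1.
Proof.
move=> j1; rewrite -(@leq_exp2l 2)//.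
apply: leq_trans (prod_primes_dyadic j1).
rewrite expnM expn_sum big_nat_cond [leqRHS]big_nat_cond.
by apply: leq_prod => p /andP[/andP[]]; rewrite expn1.
Qed.

Lemma primorial_dyadic j : 1 < j ->
  \prod_(0 <= p < 2 ^ j | prime p) p <= 2 ^ 2 ^ j.+1.
Proof.
elim: j => // j IH; rewrite ltnS leq_eqVlt => /orP[/eqP <-|j1].
  (* The base case [j = 2] is a computation: [2 * 3 <= 2 ^ 8]. *)
  by rewrite unlock.
rewrite (@big_cat_nat _ _ _ (2 ^ j)) ?leq_exp2l//=.
apply: leq_trans (leq_mul (IH j1) (prod_primes_dyadic j1)) _.
by rewrite -expnD addnn -mul2n -expnS.
Qed.

End Chebyshev.

(** * Densities *)

Section Density.
Local Open Scope ring_scope.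
Variables (R : realType) (D : {fset int}) (q : nat).

(** The part of [q] sifted so far. The cutoff [y] runs through all naturals, so that primes are
    added or removed by plain induction on [y]. *)
Definition modulus (y : nat) : nat := (\prod_(0 <= p < y | p \in primes q) p)%N.

Definition density (y : nat) : R :=
  \prod_(0 <= p < y | p \in primes q) (1 - (nu p D)%:R / p%:R).

Let prime_in p : p \in primes q -> prime p.
Proof. by rewrite mem_primes => /andP[]. Qed.

Lemma modulus_gt0 y : (0 < modulus y)%N.
Proof. by rewrite prodn_cond_gt0// => p /prime_in/prime_gt0. Qed.

Lemma modulusS_in y : y \in primes q -> modulus y.+1 = (modulus y * y)%N.
Proof. by move=> yq; rewrite /modulus big_mkcond big_nat_recr//= -big_mkcond yq. Qed.

Lemma modulusS_out y : y \notin primes q -> modulus y.+1 = modulus y.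
Proof.
move=> /negPf yq.
by rewrite /modulus big_mkcond big_nat_recr//= -big_mkcond yq muln1.
Qed.

Lemma densityS_in y : y \in primes q ->
  density y.+1 = density y * (1 - (nu y D)%:R / y%:R).
Proof. by move=> yq; rewrite /density big_mkcond big_nat_recr//= -big_mkcond yq. Qed.

Lemma densityS_out y : y \notin primes q -> density y.+1 = density y.
Proof.
move=> /negPf yq.
by rewrite /density big_mkcond big_nat_recr//= -big_mkcond yq mulr1.
Qed.

Lemma coprime_modulus y : y \in primes q -> coprime (modulus y) y.
Proof. by move=> yq; apply: coprime_prod_lt (prime_in yq). Qed.

Lemma modulus_dvd y z : (y <= z)%N -> (modulus y %| modulus z)%N.
Proof.
by move=> yz; rewrite /modulus [X in (_ %| X)%N](@big_cat_nat _ _ _ y)//= dvdn_mulr.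
Qed.

Lemma modulus_dyadic j : (1 < j)%N -> (modulus (2 ^ j) <= 2 ^ 2 ^ j.+1)%N.
Proof.
move=> j1; apply: leq_trans (primorial_dyadic j1).
rewrite /modulus big_mkcond [leqRHS]big_mkcond /=; apply: leq_prod => p _.
have [/prime_in ->//|_] := boolP (p \in primes q).
by case: ifP => // /prime_gt0.
Qed.

Hypothesis D_adm : admissible D.

Lemma local_density_gt0 p : prime p -> 0 < 1 - (nu p D)%:R / p%:R :> R.
Proof.
move=> pp; rewrite subr_gt0 ltr_pdivrMr ?ltr0n ?prime_gt0// mul1r ltr_nat.
exact: D_adm.
Qed.

Lemma local_density_le1 p : 1 - (nu p D)%:R / p%:R <= 1 :> R.
Proof. by rewrite lerBlDr lerDl divr_ge0. Qed.

Lemma density_gt0 y : 0 < density y.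
Proof. by apply: prodr_gt0 => p /prime_in; exact: local_density_gt0. Qed.

Lemma density_anti y z : (y <= z)%N -> density z <= density y.
Proof.
move=> yz; rewrite [leLHS](@big_cat_nat _ _ _ y)//= -/(density y).
rewrite ler_piMr ?(ltW (density_gt0 y))//.
apply: prodr_ile1 => p /prime_in pp.
by rewrite local_density_le1 ltW// local_density_gt0.
Qed.

Lemma density_le1 y : density y <= 1.
Proof. by have := density_anti (leq0n y); rewrite {2}/density big_geq. Qed.

(** Multiplicativity from the Chinese remainder theorem, one prime at a time: [density] is the
    proportion of good residues. *)
Lemma sum_good_modulus y :
  (\sum_(a < modulus y) good D (modulus y) a)%:R = (modulus y)%:R * density y.
Proof.
elim: y => [|y IH].
  by rewrite /modulus /density !big_geq// big_ord1 good1 mulr1.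
have [yq|yq] := boolP (y \in primes q); last by rewrite modulusS_out// densityS_out.
have py := prime_in yq; have y0 := prime_gt0 py.
rewrite modulusS_in// densityS_in// sum_goodM ?coprime_modulus ?modulus_gt0//.
rewrite natrM IH sum_good_prime// natrB ?(ltnW (D_adm py))// natrM.
by field; rewrite pnatr_eq0 -lt0n.
Qed.

(** The product counts good residues, so it is a positive integer. *)
Lemma modulus_density_ge1 y : 1 <= (modulus y)%:R * density y.
Proof.
have : 0 < (modulus y)%:R * density y.
  by rewrite mulr_gt0 ?density_gt0// ltr0n modulus_gt0.
by rewrite -sum_good_modulus ltr0n -(ler_nat R).
Qed.

Lemma prod_primes_nat (T : Type) (idx : T) (op : Monoid.com_law idx) (F : nat -> T)
    (N : nat) : (q < N)%N ->
  \big[op/idx]_(p <- primes q) F p = \big[op/idx]_(0 <= p < N | p \in primes q) F p.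
Proof.
move=> qN.
rewrite -[RHS]big_filter; apply: perm_big; apply: uniq_perm => [||p].
- exact: primes_uniq.
- by rewrite filter_uniq// iota_uniq.
rewrite mem_filter mem_index_iota /=; have [|//] := boolP (p \in primes q).
rewrite mem_primes => /and3P[_ q0 /dvdn_leq le_pq].
by rewrite (leq_ltn_trans (le_pq q0) qN).
Qed.

Section Squarefree.
Hypotheses (q0 : (0 < q)%N) (sqf : squarefree q).
Variables (N : nat) (qN : (q < N)%N).

Lemma logn_squarefree p : p \in primes q -> logn p q = 1%N.
Proof.
move=> pq; have pp := prime_in pq; apply/eqP; rewrite eqn_leq logn_gt0 pq andbT.
rewrite leqNgt -pfactor_dvdn//; apply/negP => /sqf p1.
by rewrite p1 in pp.
Qed.

Lemma modulus_full : modulus N = q.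
Proof.
rewrite /modulus -prod_primes_nat// [RHS]prod_prime_decomp// prime_decompE big_map /=.
by apply: eq_big_seq => p pq; rewrite logn_squarefree// expn1.
Qed.

Lemma density_full : (phiD D q)%:R = q%:R * density N.
Proof.
rewrite -{2}modulus_full /phiD /density /modulus !(prod_primes_nat _ _ qN) !natr_prod.
rewrite -big_split /=; apply: eq_bigr => p /prime_in pp.
have p0 : p%:R != 0 :> R by rewrite pnatr_eq0 -lt0n prime_gt0.
by rewrite natrB ?(ltnW (D_adm pp))//; field.
Qed.

Lemma totient_squarefree :
  (totient q)%:R / q%:R = \prod_(0 <= p < N | p \in primes q) (1 - p%:R^-1) :> R.
Proof.
rewrite -{2}modulus_full totientE// /modulus (prod_primes_nat _ _ qN) !natr_prod.
rewrite -prodf_div.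
apply: eq_bigr => p pq; have pp := prime_in pq.
have p0 : p%:R != 0 :> R by rewrite pnatr_eq0 -lt0n prime_gt0.
rewrite logn_squarefree// expn0 muln1 -subn1 natrB ?prime_gt0//; field.
exact: p0.
Qed.

End Squarefree.

(** The Weierstrass product inequality. *)
Lemma one_minus_sum_le_prod (P : pred nat) (x : nat -> R) m n :
  (forall p, P p -> 0 <= x p <= 1) ->
  1 - \sum_(m <= p < n | P p) x p <= \prod_(m <= p < n | P p) (1 - x p).
Proof.
move=> x01; elim: n => [|n IH]; first by rewrite !big_geq// subr0.
have [nm|mn] := ltnP n m; first by rewrite !big_geq// subr0.
rewrite big_mkcond big_nat_recr//= -big_mkcond [X in _ <= X]big_mkcond big_nat_recr//=.
rewrite -big_mkcond /=; case: ifP => [/x01/andP[x0 x1]|_]; last by rewrite addr0 mulr1.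
have S0 : 0 <= \sum_(m <= p < n | P p) x p by apply: sumr_ge0 => p /x01/andP[].
have := ler_wpM2r (_ : 0 <= 1 - x n) IH; rewrite subr_ge0 => /(_ x1).
apply: le_trans; nra.
Qed.

(** The successor gives [s >= 1] even for empty [D]. *)
Let s : R := #|` D|.+1%:R.

(* The ratio 5/4 only matters through (5/4)^2 < 2, which makes the dyadic series
   in [sum_dyadic_weights] converge. *)
Lemma density_dyadic_step j : (1 < j)%N -> 10 * s <= j%:R ->
  density (2 ^ j) <= 5 / 4 * density (2 ^ j.+1).
Proof.
move=> j1 js; rewrite {2}/density (@big_cat_nat _ _ _ (2 ^ j))//= ?leq_exp2l//.
rewrite -/(density _); set P := \prod_(2 ^ j <= p < _ | _) _.
suff : 4 / 5 <= P by have := density_gt0 (2 ^ j); nra.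
apply: le_trans (@one_minus_sum_le_prod (fun p => p \in primes q)
  (fun p => (nu p D)%:R / p%:R) _ _ _) => [|p /prime_in pp]; last first.
  by rewrite divr_ge0//= ler_pdivrMr ?ltr0n ?prime_gt0// mul1r ler_nat ltnW// D_adm.
rewrite lerBrDr -lerBrDl.
have j0 : (0 : R) < j%:R by rewrite ltr0n ltnW.
have e0 : (0 : R) < (2 ^ j)%:R by rewrite ltr0n expn_gt0.
(* With at most [2 * 2 ^ j / j] primes in the block, the sum of [nu_p / p] is at most
   [2 * s / j <= 1 / 5]. *)
have le1 : \sum_(2 ^ j <= p < 2 ^ j.+1 | p \in primes q) ((nu p D)%:R / p%:R) <=
  s / (2 ^ j)%:R * (\sum_(2 ^ j <= p < 2 ^ j.+1 | prime p) 1)%:R :> R.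
  rewrite natr_sum mulr_sumr big_nat_cond [leRHS]big_nat_cond.
  rewrite big_mkcond [leRHS]big_mkcond; apply: ler_sum => p _.
  have [pq|_] := boolP (p \in primes q); last first.
    by rewrite andbF; case: ifP => // _; rewrite mulr1 divr_ge0.
  rewrite (prime_in pq); case: ifP => // /andP[/andP[jp _] _].
  rewrite mulr1 ler_pM ?invr_ge0//; first by rewrite ler_nat ltnW// ltnS nu_le_card.
  by rewrite lef_pV2 ?posrE ?ltr0n ?(leq_trans _ jp) ?expn_gt0// ler_nat.
apply: le_trans le1 _.
have : (\sum_(2 ^ j <= p < 2 ^ j.+1 | prime p) 1)%:R <= 2 * (2 ^ j)%:R / j%:R :> R.
  by rewrite ler_pdivlMr// mulrC -!natrM ler_nat -expnS count_primes_dyadic.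
have s0 : 0 <= s / (2 ^ j)%:R by rewrite divr_ge0.
move=> /(ler_wpM2l s0) /le_trans; apply.
have -> : s / (2 ^ j)%:R * (2 * (2 ^ j)%:R / j%:R) = 2 * s / j%:R.
  by field; rewrite !lt0r_neq0.
rewrite ler_pdivrMr//; lra.
Qed.

Lemma density_dyadic J i : (1 < J)%N -> 10 * s <= J%:R ->
  density (2 ^ J) <= (5 / 4) ^+ i * density (2 ^ (J + i)).
Proof.
move=> J1 Js; elim: i => [|i IH]; first by rewrite expr0 mul1r addn0.
apply: le_trans IH _; rewrite exprSr -mulrA ler_wpM2l ?exprn_ge0 ?divr_ge0//.
rewrite addnS; apply: density_dyadic_step; first by rewrite ltn_addr.
by apply: le_trans Js _; rewrite ler_nat leq_addr.
Qed.

End Density.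

(** The block at [2 ^ (J + i)] holds at most [2 * 2 ^ (J + i) / J] primes, so the block sums decay
    with ratio [25 / 32]. The factor [1 / J] gained from Chebyshev later makes the cost of the large
    primes small. *)
Lemma sum_dyadic_weights (R : realType) (J n : nat) : (1 < J)%N ->
  \sum_(2 ^ J <= p < 2 ^ (J + n) | prime p)
    (25 / 16) ^+ (trunc_log 2 p - J) / 4 ^+ trunc_log 2 p <= 10 / (J%:R * 2 ^+ J) :> R.
Proof.
move=> J1; have J0 : (0 : R) < J%:R by rewrite ltr0n ltnW.
have e0 : (0 : R) < 2 ^+ J by rewrite exprn_gt0.
(* The closed form of the geometric sum makes the induction exact: [64 / 7 = 2 / (1 - 25 / 32)]. *)
suff : \sum_(2 ^ J <= p < 2 ^ (J + n) | prime p)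
    (25 / 16) ^+ (trunc_log 2 p - J) / 4 ^+ trunc_log 2 p <=
    64 / 7 / (J%:R * 2 ^+ J) * (1 - (25 / 32) ^+ n) :> R.
  move/le_trans; apply; rewrite ler_pdivlMr ?mulr_gt0//.
  have : 0 <= (25 / 32 : R) ^+ n by rewrite exprn_ge0// divr_ge0.
  have -> : 64 / 7 / (J%:R * 2 ^+ J) * (1 - (25 / 32) ^+ n) * (J%:R * 2 ^+ J) =
    64 / 7 * (1 - (25 / 32) ^+ n) :> R by field; rewrite !lt0r_neq0.
  lra.
elim: n => [|n IH]; first by rewrite addn0 big_geq// expr0 subrr mulr0.
rewrite (@big_cat_nat _ _ _ (2 ^ (J + n)))/= ?leq_exp2l ?leq_addr ?leq_add2l//.
have blk : \sum_(2 ^ (J + n) <= p < 2 ^ (J + n.+1) | prime p)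
    (25 / 16) ^+ (trunc_log 2 p - J) / 4 ^+ trunc_log 2 p <=
    2 / (J%:R * 2 ^+ J) * (25 / 32) ^+ n :> R.
  apply: (@le_trans _ _ ((25 / 16) ^+ n / 4 ^+ (J + n) *
      (\sum_(2 ^ (J + n) <= p < 2 ^ (J + n.+1) | prime p) 1)%:R)).
    rewrite natr_sum mulr_sumr big_nat_cond [leRHS]big_nat_cond.
    apply: ler_sum => p /andP[pb _].
    by rewrite mulr1 (@trunc_log_eq 2 (J + n))// ?addKn// -addnS.
  have cnt : (\sum_(2 ^ (J + n) <= p < 2 ^ (J + n.+1) | prime p) 1)%:R <=
      2 * 2 ^+ J * 2 ^+ n / J%:R :> R.
    rewrite ler_pdivlMr// -mulrA -exprD -exprS -natrX -natrM ler_nat addnS.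
    apply: leq_trans (@count_primes_dyadic (J + n) _); last by rewrite ltn_addr.
    by rewrite mulnC leq_mul// leq_addr.
  apply: le_trans (ler_wpM2l _ cnt) _; first by rewrite divr_ge0 ?exprn_ge0 ?divr_ge0.
  have -> : (25 / 32 : R) ^+ n = (25 / 16) ^+ n / 2 ^+ n.
    by rewrite -exprVn -exprMn; congr (_ ^+ _); field.
  have -> : (4 : R) ^+ (J + n) = (2 ^+ J * 2 ^+ n) ^+ 2.
    by rewrite -exprD -exprM mulnC exprM; congr (_ ^+ _); ring.
  have n0 : (2 : R) ^+ n != 0 by rewrite lt0r_neq0 ?exprn_gt0.
  by rewrite le_eqVlt; apply/orP; left; apply/eqP; field; rewrite n0 !lt0r_neq0.
apply: le_trans (lerD IH blk) _.
rewrite le_eqVlt; apply/orP; left; apply/eqP; rewrite [in RHS]exprS; field.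
by rewrite !lt0r_neq0.
Qed.

(** * Sifting by the large primes *)

Definition gap_starts (D : {fset int}) (q h : nat) : nat :=
  (\sum_(n < q) (survivors D q n h == 0))%N.

Section Iteration.
Local Open Scope ring_scope.
Variables (R : realType) (D : {fset int}) (q h J : nat).
Hypotheses (D_adm : admissible D) (J1 : (1 < J)%N).
(** The modulus below [2 ^ J] is at most [2 ^ 2 ^ J.+1], so the window is longer than a high power
    of it. *)
Hypothesis (hJ : (2 ^ 2 ^ (J + 5) <= h)%N).

Let s : R := #|` D|.+1%:R.
Let z := (2 ^ J)%N.
Let rho : nat -> R := density R D q.
(** The number of dyadic blocks from [z] up to [p], for [p >= z]. *)
Let level p := (trunc_log 2 p - J)%N.

(* When p times the modulus below z is at most h, the window has about h * rho z / p
   points per class mod p. For larger p only h / p + 1 is available, but then the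
   factor (5/4) ^+ level p exceeds 1 / rho z. *)
Definition hit_bound (p : nat) : R :=
  2 * s * (1 + h%:R * rho z * ((5 / 4) ^+ level p / 2 ^+ trunc_log 2 p)).

Let prime_in p : p \in primes q -> prime p.
Proof. by rewrite mem_primes => /andP[]. Qed.

Let s_ge1 : 1 <= s. Proof. by rewrite ler1n. Qed.
Let s_gt0 : 0 < s. Proof. exact: lt_le_trans s_ge1. Qed.

Let nu_le_s p : (nu p D)%:R <= s.
Proof. by rewrite ler_nat ltnW// ltnS nu_le_card. Qed.

Let two_gt0 n : (0 : R) < 2 ^+ n. Proof. by rewrite exprn_gt0. Qed.

Let pow_ge1 n : (1 : R) <= (5 / 4) ^+ n.
Proof. by apply: exprn_ege1; lra. Qed.

Let trunc_le p : (0 < p)%N -> 2 ^+ trunc_log 2 p <= p%:R :> R.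
Proof. by move=> p0; rewrite -natrX ler_nat trunc_logP. Qed.

Lemma hit_bound_ge0 p : 0 <= hit_bound p.
Proof.
rewrite /hit_bound !mulr_ge0 ?addr_ge0 ?mulr_ge0 ?invr_ge0 ?exprn_ge0 ?divr_ge0//.
by rewrite ltW// density_gt0.
Qed.

Lemma sum_hit_bound Q p n r : p \in primes q -> (z <= p)%N -> (modulus q z %| Q)%N ->
  (\sum_(m < h) (good D Q (n + m) && ~~ good D p (r + m)))%:R <= hit_bound p.
Proof.
move=> pq zp zQ; have pp := prime_in pq; have p0 := prime_gt0 pp.
have p0R : (0 : R) < p%:R by rewrite ltr0n.
set Q0 := modulus q z in zQ *; have Q00 : (0 < Q0)%N := modulus_gt0 q z.
have Q00R : (0 : R) < Q0%:R by rewrite ltr0n.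
have cop : coprime Q0 p.
  by apply: coprime_dvdl (coprime_modulus pq); apply: modulus_dvd.
(* Sifting by the larger [Q] only removes points, so it suffices to count with the modulus below
   [z]. *)
have rho0 : 0 < rho z := density_gt0 R q D_adm z.
set c := (\sum_(m < h) (good D Q0 (n + m) && ~~ good D p (r + m)))%N.
apply: (@le_trans _ _ c%:R).
  rewrite ler_nat; apply: leq_sum => m _.
  have := @good_dvd D _ _ (n + m) zQ.
  by case: (good D Q _) => // /(_ isT) ->.
have tl := trunc_le p0.
have [Qph|hQp] := leqP (Q0 * p) h.
  have := sum_hit_le D cop Q00 pp n r Qph; rewrite -/c -(ler_nat R) !natrM.
  rewrite sum_good_modulus// -/Q0 => hit.
  have {}hit : p%:R * c%:R <= 2 * h%:R * rho z * s.
    rewrite -(ler_pM2l Q00R).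
    have : 0 <= 2 * h%:R * (Q0%:R * rho z) by rewrite !mulr_ge0// ltW.
    move=> /(ler_wpM2l)/(_ _ _ (nu_le_s p)); rewrite -/rho in hit *; lra.
  have : c%:R <= 2 * h%:R * rho z * s / p%:R by rewrite ler_pdivlMr// mulrC.
  move=> /le_trans; apply.
  rewrite /hit_bound.
  have A0 : 0 <= 2 * s * (h%:R * rho z) by rewrite !mulr_ge0// ltW.
  have le_inv : p%:R^-1 <= (5 / 4) ^+ level p / 2 ^+ trunc_log 2 p :> R.
    rewrite -[p%:R^-1]mul1r ler_pM ?invr_ge0 ?ler0n//.
    by rewrite lef_pV2 ?posrE.
  have := ler_wpM2l A0 le_inv; have := s_gt0; lra.
have := sum_hit_trivial D Q0 pp n r h; rewrite -/c -(ler_nat R) natrM => hit.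
have div_le : (h %/ p)%:R <= h%:R / p%:R :> R.
  by rewrite ler_pdivlMr// -natrM ler_nat leq_trunc_div.
have {}hit : c%:R <= (h%:R / p%:R + 1) * s.
  apply: le_trans hit _; rewrite -addn1 natrD.
  by apply: ler_pM => //; rewrite ?addr_ge0// lerD2r.
have Q0le : (Q0 <= 2 ^ 2 ^ J.+1)%N by apply: modulus_dyadic.
(* Here [Q0 * p > h] while [Q0] is tiny, which forces [p] to be huge. The 4 is chosen because
   [(5 / 4) ^+ 4 >= 2], so that [(5 / 4) ^+ level p] exceeds [Q0], hence [1 / rho z]. *)
have lev : (4 * 2 ^ J.+1 <= level p)%N.
  have plt : (p < 2 ^ (trunc_log 2 p).+1)%N by apply: trunc_log_ltn.
  have : (2 ^ 2 ^ (J + 5) < 2 ^ (2 ^ J.+1 + (trunc_log 2 p).+1))%N.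
    apply: (leq_ltn_trans hJ); apply: (leq_trans hQp).
    by rewrite expnD leq_mul// ltnW.
  rewrite ltn_exp2l// expnD !expnS expn0 /level.
  have := ltn_expl J (isT : (1 < 2)%N); lia.
have big : 1 <= 2 * rho z * (5 / 4) ^+ level p.
  have h1 : (2 : R) ^+ (2 ^ J.+1) <= (5 / 4) ^+ level p.
    apply: (@le_trans _ _ ((5 / 4) ^+ (4 * 2 ^ J.+1))).
      by rewrite exprM; apply: lerXn2r; rewrite ?nnegrE ?exprn_ge0 ?divr_ge0//; lra.
    by rewrite ler_weXn2l//; lra.
  have h2 : 1 <= Q0%:R * rho z := modulus_density_ge1 R q D_adm z.
  have h3 : Q0%:R <= (2 : R) ^+ (2 ^ J.+1) by rewrite -natrX ler_nat.
  have h4 : Q0%:R * rho z <= (5 / 4) ^+ level p * rho z.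
    by rewrite ler_wpM2r ?(ltW rho0)//; exact: le_trans h3 h1.
  lra.
apply: le_trans hit _.
have le_p : h%:R / p%:R <= h%:R / 2 ^+ trunc_log 2 p :> R.
  by rewrite ler_wpM2l// lef_pV2 ?posrE.
have : h%:R / 2 ^+ trunc_log 2 p * 1 <=
  h%:R / 2 ^+ trunc_log 2 p * (2 * rho z * (5 / 4) ^+ level p).
  by rewrite ler_wpM2l// divr_ge0// ltW.
rewrite mulr1 => le_big; rewrite /hit_bound.
have -> : 2 * s * (1 + h%:R * rho z * ((5 / 4) ^+ level p / 2 ^+ trunc_log 2 p)) =
  (h%:R / 2 ^+ trunc_log 2 p * (2 * rho z * (5 / 4) ^+ level p) + 2) * s by ring.
by rewrite ler_pM2r//; lra.
Qed.

Variables (X : R) (N : nat).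
(** [X] caps the products [t * K_p]; [zX] makes [nu_p / p] small against [1 / (expR X * X)] for
    every [p >= z]. All primes of [q] lie below [N]. *)
Hypotheses (X1 : 1 <= X) (Js : 10 * s <= J%:R) (zX : 4 * expR X * X * s <= 2 ^+ J).
Hypotheses (qN : (q < N)%N) (zN : (z <= N)%N).

Let M : R := expR X.
(* The exponent used once only the primes below y remain is 1 / (w y * rho y). The
   cost of p is chosen so that passing from p.+1 to p is [exponent_step], and w0 so
   that t * K_p <= X always holds. *)
Let w0 : R := (2 * s / rho N + 5 / 2 * s * h%:R / 2 ^+ J) / X.
Let cost p : R := 2 * M * ((nu p D)%:R / p%:R) * hit_bound p / rho p.+1.
Let w y : R := w0 + \sum_(y <= p < N | p \in primes q) cost p.

Let M_ge1 : 1 <= M.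
Proof. by have := expR_ge1Dx X; rewrite /M; have := X1; lra. Qed.

Let M_ge0 : 0 <= M. Proof. exact: expR_ge0. Qed.

Let rho_gt0 y : 0 < rho y. Proof. exact: density_gt0. Qed.

Let in_ltN p : p \in primes q -> (p < N)%N.
Proof.
by rewrite mem_primes => /and3P[_ q0 /(dvdn_leq q0)] /leq_ltn_trans; apply.
Qed.

Let trunc_ge p : (z <= p)%N -> (J <= trunc_log 2 p)%N.
Proof. by move=> zp; rewrite -[J](@trunc_expnK 2)// leq_trunc_log. Qed.

Lemma density_ratio p : (z <= p)%N ->
  rho z <= (5 / 4) ^+ (level p).+1 * rho p.+1.
Proof.
move=> zp; apply: le_trans (density_dyadic q D_adm (level p).+1 J1 Js) _.
rewrite ler_pM2l ?exprn_gt0 ?divr_gt0//; apply: density_anti => //.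
by rewrite addnS subnKC ?trunc_ge// trunc_log_ltn.
Qed.

(** One power [(5 / 4) ^+ level p] comes from [hit_bound], another from [density_ratio]; together
    they give [25 / 16], and the extra step of the latter turns 2 into [5 / 2]. *)
Lemma hit_bound_ratio p : (z <= p)%N ->
  hit_bound p / rho p.+1 <= 2 * s / rho p.+1 +
    5 / 2 * s * h%:R * ((25 / 16) ^+ level p / 2 ^+ trunc_log 2 p).
Proof.
move=> zp; have r := density_ratio zp; have r0 := rho_gt0 p.+1.
rewrite ler_pdivrMr// mulrDl mulfVK ?lt0r_neq0//.
have -> : (25 / 16 : R) ^+ level p = (5 / 4) ^+ level p * (5 / 4) ^+ level p.
  by rewrite -exprMn; congr (_ ^+ _); field.
rewrite exprS in r.
have c0 : 0 <= 2 * s * h%:R * ((5 / 4) ^+ level p / 2 ^+ trunc_log 2 p).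
  by rewrite !mulr_ge0 ?invr_ge0 ?exprn_ge0 ?divr_ge0.
have := ler_wpM2l c0 r; rewrite /hit_bound; lra.
Qed.

Let w0_gt0 : 0 < w0.
Proof.
rewrite divr_gt0 ?(lt_le_trans ltr01 X1)// ltr_pwDl ?divr_gt0 ?mulr_gt0//.
by rewrite !mulr_ge0 ?invr_ge0 ?exprn_ge0.
Qed.

(** Since [25 / 16 <= 2], the second term of [hit_bound_ratio] is largest at level 0; [w0] is the
    resulting bound divided by [X]. *)
Lemma hit_bound_le p : (z <= p < N)%N -> hit_bound p <= X * w0 * rho p.+1.
Proof.
move=> /andP[zp pN]; have r0 := rho_gt0 p.+1; rewrite -ler_pdivrMr//.
apply: le_trans (hit_bound_ratio zp) _.
have X0 : X != 0 by rewrite lt0r_neq0// (lt_le_trans ltr01).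
rewrite /w0 [leRHS]mulrC mulfVK//; apply: lerD.
  rewrite ler_wpM2l ?mulr_ge0// lef_pV2 ?posrE//.
  by apply: density_anti.
rewrite ler_wpM2l ?mulr_ge0 ?invr_ge0//.
rewrite -(subnKC (trunc_ge zp)) exprD invfM -/(level p).
rewrite mulrCA -[leRHS]mulr1 ler_wpM2l ?invr_ge0 ?exprn_ge0//.
rewrite ler_pdivrMr ?exprn_gt0// mul1r.
by apply: lerXn2r; rewrite ?nnegrE ?divr_ge0//; lra.
Qed.

Let cost_ge0 p : 0 <= cost p.
Proof.
rewrite /cost divr_ge0 ?(ltW (rho_gt0 _))// mulr_ge0 ?hit_bound_ge0//.
by rewrite !mulr_ge0 ?invr_ge0.
Qed.

Let w_gt0 y : 0 < w y.
Proof. by rewrite ltr_pwDl// sumr_ge0. Qed.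

Let wS y : (y < N)%N -> y \in primes q -> w y = w y.+1 + cost y.
Proof. by move=> yN yq; rewrite /w big_ltn_cond// yq addrCA addrC. Qed.

Let wS_out y : y \notin primes q -> w y = w y.+1.
Proof.
move=> /negPf yq; rewrite /w; have [yN|Ny] := ltnP y N.
  by rewrite big_ltn_cond// yq.
by rewrite !big_geq// leqW.
Qed.

(** The survivors average [h * rho y], so dividing by [w y * rho y] normalises the typical exponent
    to [h / w y]. *)
Definition laplace y : R :=
  (\sum_(n < modulus q y)
     expR (- ((w y * rho y)^-1 * (survivors D (modulus q y) n h)%:R)))
  / (modulus q y)%:R.

(** After clearing denominators the excess is a positive multiple of
    [b * ((1 - 2 * a) * u - 2 * b)], and [(1 - 2 * a) * u >= u / 2 >= 2 * b]. *)
Lemma exponent_step (u a b : R) : 0 < u -> 0 <= a <= 1 / 4 -> 0 <= b <= u / 4 ->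
  (1 - a) / (u + 2 * b) <= u^-1 * (1 - a - b / u).
Proof.
move=> u0 /andP[a0 a4] /andP[b0 b4].
have ub0 : 0 < u + 2 * b by lra.
rewrite ler_pdivrMr//.
have -> : u^-1 * (1 - a - b / u) * (u + 2 * b) =
    (1 - a) + b * ((1 - 2 * a) * u - 2 * b) / (u * u).
  by field; rewrite lt0r_neq0.
rewrite lerDl divr_ge0 ?mulr_ge0 ?(ltW u0)//; nra.
Qed.

(** For [y] a prime of [q], this is [laplace_step] with [t = 1 / (w y.+1 * rho y.+1)]; [cost y] pays
    for the loss in the exponent. *)
Lemma laplace_anti y : (z <= y)%N -> laplace y.+1 <= laplace y.
Proof.
move=> zy; have [yq|yq] := boolP (y \in primes q); last first.
  by rewrite /laplace -wS_out// modulusS_out// /rho densityS_out.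
have py := prime_in yq; have y0 := prime_gt0 py; have yN := in_ltN yq.
have y0R : (0 : R) < y%:R by rewrite ltr0n.
have zyR : 2 ^+ J <= y%:R :> R by rewrite -natrX ler_nat.
have r0 := rho_gt0 y; have r1 := rho_gt0 y.+1.
set u := w y.+1 * rho y.+1; have u0 : 0 < u by rewrite mulr_gt0.
set K := hit_bound y; have K0 : 0 <= K := hit_bound_ge0 y.
have XX : 0 < X := lt_le_trans ltr01 X1.
have KXu : K <= X * u.
  apply: (@le_trans _ _ (X * w0 * rho y.+1)); first by rewrite hit_bound_le// zy.
  rewrite -mulrA ler_pM2l// ler_pM2r// lerDl sumr_ge0//.
pose a : R := (nu y D)%:R / y%:R; have a0 : 0 <= a by rewrite divr_ge0.
have aMX : a * (4 * M * X) <= 1.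
  rewrite /a mulrAC ler_pdivrMr// mul1r; apply: le_trans zyR; apply: le_trans zX.
  by rewrite mulrC ler_wpM2l//; rewrite !mulr_ge0// ?(ltW XX)//.
have MX1 : 1 <= M * X by rewrite mulr_ege1.
have a4 : a <= 1 / 4 by nra.
set b := a * (M * K).
have b0 : 0 <= b by rewrite mulr_ge0 ?(mulr_ge0 M_ge0 K0).
have b4 : b <= u / 4.
  have h1 : M * K <= M * (X * u) by rewrite ler_wpM2l.
  have h2 : b <= a * (M * (X * u)) by rewrite ler_wpM2l.
  have h3 : a * (4 * M * X) * u <= 1 * u by rewrite ler_wpM2r// ltW.
  lra.
have tKX : u^-1 * K <= X by rewrite mulrC ler_pdivrMr.
have hits n r :
    (\sum_(m < h) (good D (modulus q y) (n + m) && ~~ good D y (r + m)))%:R <= K.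
  by apply: sum_hit_bound => //; apply: modulus_dvd.
have step := laplace_step (coprime_modulus yq) (modulus_gt0 q y) py
  (_ : 0 <= u^-1) K0 tKX hits.
have m0 := modulus_gt0 q y.
rewrite /laplace modulusS_in// ler_pdivrMr ?ltr0n ?muln_gt0 ?m0//.
rewrite [leRHS]mulrC natrM mulrAC [_ * (_ / _)]mulrCA.
rewrite divff ?pnatr_eq0 -?lt0n// mulr1 [leRHS]mulrC.
apply: le_trans (step _) _; first by rewrite invr_ge0 ltW.
rewrite ler_pM2l//; apply: ler_sum => n _; rewrite ler_expR lerN2 ler_wpM2r//.
(* [cost y * rho y.+1] is [2 * b], and passing from [rho y.+1] to [rho y] divides by [1 - a]; this
   is the shape treated by [exponent_step]. *)
have wr : w y * rho y = (u + 2 * b) / (1 - a).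
  have a1 : 1 - a != 0 by rewrite lt0r_neq0//; lra.
  rewrite wS// /cost -/K -/a /u /rho densityS_in// -/a /b; field.
  by rewrite a1 lt0r_neq0.
rewrite wr invf_div; apply: le_trans (exponent_step u0 _ _) _.
- by rewrite a0.
- by rewrite b0.
by rewrite ler_pM2l ?invr_gt0// -/a -/M /b; lra.
Qed.

Lemma laplace_le : laplace N <= laplace z.
Proof.
have gen d : laplace (z + d) <= laplace z.
  elim: d => [|d IH]; first by rewrite addn0.
  by rewrite addnS; apply: le_trans (laplace_anti _) IH; apply: leq_addr.
by rewrite -(subnKC zN).
Qed.

(** Below [z] the bound is pointwise: every window has at least [h * rho z / 2] survivors, and
    [rho z] cancels. *)
Lemma laplace_start : laplace z <= expR (- (h%:R / (2 * w z))).
Proof.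
set Q := modulus q z; have Q0 : (0 < Q)%N := modulus_gt0 q z.
have Q0R : (0 : R) < Q%:R by rewrite ltr0n.
have rz := rho_gt0 z; have wz := w_gt0 z.
rewrite /laplace ler_pdivrMr//.
have Qh : (2 * Q <= h)%N.
  apply: leq_trans hJ; apply: (@leq_trans (2 ^ 1 * 2 ^ 2 ^ J.+1)).
    by rewrite leq_mul//; apply: modulus_dyadic.
  rewrite -expnD leq_exp2l// expnD !expnS expn0.
  by have := expn_gt0 2 J; lia.
apply: (@le_trans _ _ (\sum_(n < Q) expR (- (h%:R / (2 * w z))))); last first.
  by rewrite sumr_const card_ord mulr_natr.
apply: ler_sum => n _; rewrite ler_expR lerN2.
have := survivors_ge D n Q0 Qh; rewrite -(ler_nat R) !natrM.
rewrite sum_good_modulus// -/Q -/rho => le_surv.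
rewrite [leRHS]mulrC ler_pdivlMr ?mulr_gt0//.
have -> : h%:R / (2 * w z) * (w z * rho z) = h%:R * rho z / 2.
  by field; rewrite lt0r_neq0.
rewrite ler_pdivrMr// -(ler_pM2l Q0R); lra.
Qed.

(** The main part of [cost p] is a multiple of [(nu_p / p) / rho p.+1], which equals
    [1 / rho p.+1 - 1 / rho p] and telescopes. The rest is summed by [sum_dyadic_weights]. *)
Lemma weight_le :
  w z <= 6 * s * M / rho N + h%:R / 2 ^+ J * (5 / 2 * s / X + 50 * s ^+ 2 * M / J%:R).
Proof.
have J0 : (0 : R) < J%:R by rewrite ltr0n ltnW.
have XX : 0 < X := lt_le_trans ltr01 X1.
have term p : (z <= p < N)%N && (p \in primes q) -> cost p <=
    4 * s * M * ((rho p.+1)^-1 - (rho p)^-1) +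
    5 * s ^+ 2 * M * h%:R * ((25 / 16) ^+ level p / 4 ^+ trunc_log 2 p).
  move=> /andP[/andP[zp pN] pq]; have pp := prime_in pq; have p0 := prime_gt0 pp.
  have p0R : (0 : R) < p%:R by rewrite ltr0n.
  have l0 : 1 - (nu p D)%:R / p%:R != 0 :> R by rewrite lt0r_neq0// local_density_gt0.
  have -> : (rho p.+1)^-1 - (rho p)^-1 = (nu p D)%:R / p%:R / rho p.+1.
    rewrite /rho densityS_in//; set a := (nu p D)%:R / p%:R in l0 *.
    by field; rewrite l0 lt0r_neq0 ?rho_gt0.
  set a := (nu p D)%:R / p%:R.
  have a0 : 0 <= a by rewrite divr_ge0.
  have as_ : a <= s / 2 ^+ trunc_log 2 p.
    by rewrite ler_pM ?invr_ge0// lef_pV2 ?posrE//; apply: trunc_le.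
  have Ma : 0 <= 2 * M * a by apply: mulr_ge0 a0; apply: mulr_ge0.
  have := ler_wpM2l Ma (hit_bound_ratio zp).
  rewrite /cost -/a; set B := (25 / 16) ^+ level p.
  have -> : (4 : R) ^+ trunc_log 2 p = 2 ^+ trunc_log 2 p * 2 ^+ trunc_log 2 p.
    by rewrite -exprMn; congr (_ ^+ _); ring.
  have c0 : 0 <= 5 * s * M * h%:R * (B / 2 ^+ trunc_log 2 p).
    by rewrite !mulr_ge0 ?invr_ge0 ?exprn_ge0 ?divr_ge0.
  have := ler_wpM2l c0 as_; rewrite invfM; lra.
have tele : \sum_(z <= p < N | p \in primes q) ((rho p.+1)^-1 - (rho p)^-1) <= (rho N)^-1.
  rewrite (eq_bigl (fun p => (p \in primes q) && true)); last by move=> p; rewrite andbT.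
  rewrite [leLHS](_ : _ = \sum_(z <= p < N) ((rho p.+1)^-1 - (rho p)^-1)).
    by rewrite telescope_sumr// lerBlDr lerDl invr_ge0 ltW.
  rewrite big_mkcond; apply: eq_bigr => p _.
  by have [|pq] := boolP (p \in primes q); rewrite //= /rho densityS_out// subrr.
have weights :
    \sum_(z <= p < N | p \in primes q) ((25 / 16) ^+ level p / 4 ^+ trunc_log 2 p)
    <= 10 / (J%:R * 2 ^+ J) :> R.
  apply: le_trans (@sum_dyadic_weights R J N J1).
  have nn p : 0 <= (25 / 16) ^+ (trunc_log 2 p - J) / 4 ^+ trunc_log 2 p :> R.
    by rewrite divr_ge0 ?exprn_ge0 ?divr_ge0.
  have NN : (N <= 2 ^ (J + N))%N.
    apply: leq_trans (ltnW (ltn_expl N (isT : (1 < 2)%N))) _.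
    by rewrite leq_exp2l// leq_addl.
  rewrite [leRHS](@big_cat_nat _ _ _ N)//= ler_wpDr ?sumr_ge0//.
  rewrite big_mkcond [leRHS]big_mkcond; apply: ler_sum => p _.
  by have [/prime_in ->//|_] := boolP (p \in primes q); case: ifP.
have : \sum_(z <= p < N | p \in primes q) cost p <=
    4 * s * M / rho N + 5 * s ^+ 2 * M * h%:R * (10 / (J%:R * 2 ^+ J)).
  rewrite big_nat_cond; apply: le_trans (ler_sum _ term) _.
  rewrite -big_nat_cond big_split /= -!mulr_sumr; apply: lerD.
    by rewrite ler_wpM2l// !mulr_ge0.
  by rewrite ler_wpM2l// !mulr_ge0.
have : 2 * s / rho N / X <= 2 * s * M / rho N.
  rewrite mulrAC ler_pM2r ?invr_gt0// ler_pdivrMr//.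
  have s2 : 0 <= 2 * s by rewrite mulr_ge0.
  by have := ler_wpM2l s2 (mulr_ege1 M_ge1 X1); lra.
have -> : 5 * s ^+ 2 * M * h%:R * (10 / (J%:R * 2 ^+ J)) =
  h%:R / 2 ^+ J * (50 * s ^+ 2 * M / J%:R).
  by field; rewrite !lt0r_neq0.
rewrite /w; set S := \sum_(_ <= _ < _ | _) _.
have -> : w0 = 2 * s / rho N / X + h%:R / 2 ^+ J * (5 / 2 * s / X).
  by rewrite /w0; field; rewrite !lt0r_neq0.
lra.
Qed.

(** A window without survivors contributes [expR 0 = 1] to the sum in [laplace N]. *)
Lemma gap_starts_le : (0 < q)%N -> squarefree q ->
  (gap_starts D q h)%:R <= q%:R * expR (- (h%:R / (2 *
    (6 * s * M / rho N + h%:R / 2 ^+ J * (5 / 2 * s / X + 50 * s ^+ 2 * M / J%:R))))).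
Proof.
move=> q0 sqf; have mN := modulus_full q0 sqf qN.
have q0R : (0 : R) < q%:R by rewrite ltr0n.
apply: (@le_trans _ _ (q%:R * laplace N)).
  rewrite /laplace mulrC mN divfK ?lt0r_neq0// natr_sum; apply: ler_sum => n _.
  have [->|_] := eqVneq (survivors D q n h) 0%N; last exact: expR_ge0.
  by rewrite mulr0 oppr0 expR0.
rewrite ler_pM2l//; apply: le_trans laplace_le _; apply: le_trans laplace_start _.
rewrite ler_expR lerN2 ler_wpM2l// lef_pV2 ?posrE ?mulr_gt0//.
  by rewrite ler_pM2l// weight_le.
exact: lt_le_trans (w_gt0 z) weight_le.
Qed.

End Iteration.

(** * Arbitrary powers *)

Section Moments.
Local Open Scope ring_scope.
Variable R : realType.

Lemma expR_ge_pow (k : nat) (x : R) : 0 <= x -> (1 + x) ^+ k <= expR (k%:R * x).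
Proof.
move=> x0; rewrite expRM_natl; apply: lerXn2r; rewrite ?nnegrE ?expR_ge0 ?addr_ge0//.
exact: expR_ge1Dx.
Qed.

(** Take [x = T / (k * A)] in [expR_ge_pow], and use [1 + T <= k * A + T]. *)
Lemma pow_expRN_le (k : nat) (A T : R) : (0 < k)%N -> 1 <= A -> 0 <= T ->
  (1 + T) ^+ k * expR (- (T / A)) <= (k%:R * A) ^+ k.
Proof.
move=> k0 A1 T0; have A0 : 0 < A := lt_le_trans ltr01 A1.
have kR : (0 : R) < k%:R by rewrite ltr0n.
have k1 : (1 : R) <= k%:R by rewrite ler1n.
have kA : 1 <= k%:R * A by rewrite mulr_ege1.
have x0 : 0 <= T / (k%:R * A) by rewrite divr_ge0// ltW// mulr_gt0.
have := expR_ge_pow k x0.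
have -> : k%:R * (T / (k%:R * A)) = T / A by field; rewrite !lt0r_neq0.
move=> h; rewrite expRN ler_pdivrMr ?expR_gt0//.
apply: (@le_trans _ _ ((k%:R * A) ^+ k * (1 + T / (k%:R * A)) ^+ k)); last first.
  by rewrite ler_wpM2l// exprn_ge0// ltW// mulr_gt0.
rewrite -exprMn; apply: lerXn2r; rewrite ?nnegrE ?mulr_ge0 ?addr_ge0 ?(ltW A0)//.
have -> : k%:R * A * (1 + T / (k%:R * A)) = k%:R * A + T.
  by field; rewrite !lt0r_neq0.
lra.
Qed.

Lemma two_pow_le_expR (n : nat) : 2 ^+ n <= expR n%:R :> R.
Proof. by have := expR_ge_pow n (@ler01 R); rewrite mulr1. Qed.

(** Chooses [J] so that the binary logarithm of [h] lies between [32 * 2 ^ J] and [64 * 2 ^ J]. *)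
Lemma dyadic_scale (J0 h : nat) : (2 ^ 2 ^ (J0 + 5) <= h)%N ->
  exists J, [/\ (J0 <= J)%N, (2 ^ 2 ^ (J + 5) <= h)%N & (h < 2 ^ (64 * 2 ^ J))%N].
Proof.
move=> hJ; have h0 : (0 < h)%N by apply: leq_trans hJ; rewrite expn_gt0.
pose L := trunc_log 2 h.
have LJ : (2 ^ (J0 + 5) <= L)%N by rewrite /L trunc_log_max.
have L0 : (0 < L)%N by apply: leq_trans LJ; rewrite expn_gt0.
have J5 : (J0 + 5 <= trunc_log 2 L)%N by rewrite trunc_log_max.
exists (trunc_log 2 L - 5)%N; split.
- by lia.
- rewrite subnK ?(leq_trans _ J5) ?leq_addl//.
  by apply: leq_trans (trunc_logP (isT : (1 < 2)%N) h0); rewrite leq_exp2l// trunc_logP.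
- apply: leq_trans (trunc_log_ltn h (isT : (1 < 2)%N)) _; rewrite leq_exp2l//.
  rewrite -[64%N]/(2 ^ 6)%N -expnD.
  have -> : (6 + (trunc_log 2 L - 5) = (trunc_log 2 L).+1)%N by lia.
  exact: trunc_log_ltn.
Qed.

Variable D : {fset int}.
Hypothesis D_adm : admissible D.

Lemma gap_starts_moment (k : nat) : (0 < k)%N -> exists2 C : R, 0 < C &
  forall q h : nat, (0 < q)%N -> squarefree q ->
  (gap_starts D q h)%:R * (1 + h%:R * ((phiD D q)%:R / q%:R)) ^+ k <= C * q%:R.
Proof.
move=> k0; pose s : R := #|` D|.+1%:R.
have s1 : 1 <= s by rewrite ler1n.
have k1 : (1 : R) <= k%:R by rewrite ler1n.
(* [X] makes [5 / 2 * s / X] at most [1 / (520 * k)]; then [B] gathers the lower bounds on [J], its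
   [260 * 100] doing the same for the term [50 * s ^+ 2 * M / J]. *)
pose X : R := (Num.truncn (13 * 100 * k%:R * s)).+1%:R.
have X1 : 1 <= X by rewrite ler1n.
have XX : 0 < X := lt_le_trans ltr01 X1.
have Xbig : 13 * 100 * k%:R * s <= X by rewrite ltW// truncnS_gt.
pose M := expR X.
have M1 : 1 <= M by have := expR_ge1Dx X; rewrite /M; lra.
have s0 : 0 < s := lt_le_trans ltr01 s1.
have M0 : 0 < M := lt_le_trans ltr01 M1.
pose B : R := 10 * s + 4 * M * X * s + 260 * 100 * k%:R * s ^+ 2 * M + 2.
pose J0 := (Num.truncn B).+1.
have J0big : B <= J0%:R by rewrite ltW// truncnS_gt.
pose A : R := 24 * s * M.
have A1 : 1 <= A by rewrite /A; nra.
have [H0 H00 H0E] : exists2 H0 : R, 0 <= H0 &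
    forall h, (h < 2 ^ 2 ^ (J0 + 5))%N -> h%:R <= H0.
  by exists (2 ^+ (2 ^ (J0 + 5))) => [|h /ltnW]; rewrite ?exprn_ge0// -natrX ler_nat.
have c1 : 0 <= (k%:R * A) ^+ k by rewrite exprn_ge0// mulr_ge0// (le_trans _ A1).
have c2 : 0 <= (1 + H0) ^+ k by rewrite exprn_ge0// addr_ge0.
exists (1 + (k%:R * A) ^+ k + (1 + H0) ^+ k); first by rewrite ltr_wpDr// ltr_wpDr.
move=> q h q0 sqf; have q0R : (0 : R) < q%:R by rewrite ltr0n.
set rho := (phiD D q)%:R / q%:R.
have rhoE N : (q < N)%N -> rho = density R D q N.
  by move=> qN; rewrite /rho (density_full R D_adm q0 sqf qN) mulrC mulKf ?lt0r_neq0.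
have rho0 : 0 < rho by rewrite (rhoE q.+1)// density_gt0.
have rho1 : rho <= 1 by rewrite (rhoE q.+1)// density_le1.
have T0 : 0 <= h%:R * rho by rewrite mulr_ge0// ltW.
have Th : h%:R * rho <= h%:R by rewrite ler_piMr.
have Tk0 : 0 <= (1 + h%:R * rho) ^+ k by rewrite exprn_ge0// addr_ge0.
(* Bounded [h]: the trivial bound [gap_starts D q h <= q] suffices. *)
have [hsmall|hbig] := ltnP h (2 ^ 2 ^ (J0 + 5))%N.
  rewrite [leRHS]mulrC; apply: ler_pM => //.
    rewrite ler_nat -[leqRHS]card_ord -sum1_card; apply: leq_sum => n _.
    exact: leq_b1.
  apply: (@le_trans _ _ ((1 + H0) ^+ k)); last by rewrite lerDr addr_ge0.
  apply: lerXn2r; rewrite ?nnegrE ?addr_ge0// lerD2l; exact: le_trans Th (H0E _ hsmall).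
have [J [J0J hJ hJ']] := dyadic_scale hbig.
have JB : B <= J%:R by rewrite (le_trans J0big)// ler_nat.
have J2 : (J%:R : R) <= 2 ^+ J by rewrite -natrX ler_nat ltnW// ltn_expl.
have sM : 0 <= 260 * 100 * k%:R * s ^+ 2 * M.
  by rewrite !mulr_ge0// ?exprn_ge0// ?(le_trans _ M1)// (le_trans _ s1).
have MXs : 0 <= 4 * M * X * s.
  by rewrite !mulr_ge0// ?(le_trans _ M1)// (le_trans _ s1).
have J1 : (1 < J)%N by rewrite -(ler_nat R); rewrite /B in JB; lra.
have Js : 10 * s <= J%:R by rewrite /B in JB; lra.
have zX : 4 * M * X * s <= 2 ^+ J by rewrite /B in JB; lra.
pose N := (q + 2 ^ J).+1.
have qN : (q < N)%N by rewrite ltnS leq_addr.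
have zN : (2 ^ J <= N)%N by rewrite leqW// leq_addl.
have := gap_starts_le D_adm J1 hJ X1 Js zX qN zN q0 sqf.
rewrite -(rhoE N qN) -/s -/M; set W := _ + _ => G.
have h0 : (0 : R) < h%:R by rewrite ltr0n (leq_trans _ hJ)// expn_gt0.
have z0 : (0 : R) < 2 ^+ J by rewrite exprn_gt0.
have Jp : (0 : R) < J%:R by rewrite ltr0n ltnW.
have d1 : 5 / 2 * s / X <= 1 / 520 / k%:R.
  by rewrite ler_pdivrMr// [leRHS]mulrAC ler_pdivlMr ?ltr0n//; lra.
have d2 : 50 * s ^+ 2 * M / J%:R <= 1 / 520 / k%:R.
  by rewrite ler_pdivrMr// [leRHS]mulrAC ler_pdivlMr ?ltr0n//; rewrite /B in JB; lra.
have hz0 : 0 < h%:R / 2 ^+ J :> R by rewrite divr_gt0.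
have Wle : W <= 6 * s * M / rho + h%:R / 2 ^+ J * (1 / 260 / k%:R).
  rewrite lerD2l ler_pM2l//; apply: le_trans (lerD d1 d2) _.
  by rewrite le_eqVlt; apply/orP; left; apply/eqP; field; rewrite pnatr_eq0 -lt0n.
have W1 : 0 < 6 * s * M / rho.
  by rewrite divr_gt0// !mulr_gt0// ?(lt_le_trans ltr01 M1)// (lt_le_trans ltr01 s1).
have W0 : 0 < W.
  rewrite ltr_wpDr// mulr_ge0 ?(ltW hz0)//; apply: addr_ge0; apply: divr_ge0;
    by rewrite ?(ltW XX) ?(ltW Jp) ?mulr_ge0 ?invr_ge0 ?exprn_ge0 ?(ltW s0) ?(ltW M0).
apply: le_trans (ler_wpM2r Tk0 G) _.
rewrite -mulrA mulrC ler_pM2r// mulrC.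
(* If the second term of [W] dominates, the exponent is at least [65 * k * 2 ^+ J], which beats
   [(2 * h) ^+ k] because [h < 2 ^ (64 * 2 ^ J)]. Otherwise it is at least [h * rho / A], and
   [pow_expRN_le] applies. *)
have [small|large] := lerP (6 * s * M / rho) (h%:R / 2 ^+ J * (1 / 260 / k%:R)).
  apply: (@le_trans _ _ 1); last by rewrite -addrA lerDl addr_ge0.
  have kR : (0 : R) < k%:R by rewrite ltr0n.
  have ex : 65 * k%:R * 2 ^+ J <= h%:R / (2 * W).
    rewrite ler_pdivlMr ?mulr_gt0//.
    have W2 : W <= 2 * (h%:R / 2 ^+ J * (1 / 260 / k%:R)) by lra.
    have c0 : 0 <= 130 * k%:R * 2 ^+ J :> R by rewrite !mulr_ge0// ltW.
    have := ler_wpM2l c0 W2.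
    have -> : 130 * k%:R * 2 ^+ J * (2 * (h%:R / 2 ^+ J * (1 / 260 / k%:R))) = h%:R :> R.
      by field; rewrite !lt0r_neq0.
    lra.
  have pow : (1 + h%:R * rho) ^+ k <= expR (65 * k%:R * 2 ^+ J).
    apply: (@le_trans _ _ ((2 ^+ (65 * 2 ^ J)) ^+ k)).
      apply: lerXn2r; rewrite ?nnegrE ?exprn_ge0 ?addr_ge0//.
      have h64 : h%:R <= (2 : R) ^+ (64 * 2 ^ J) by rewrite -natrX ler_nat ltnW.
      have two1 : 1 + h%:R * rho <= 2 * h%:R.
        have : (1 : R) <= h%:R by rewrite ler1n -(ltr0n R).
        lra.
      apply: le_trans two1 _.
      have -> : (65 * 2 ^ J = 64 * 2 ^ J + 2 ^ J)%N by rewrite mulSn addnC.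
      rewrite exprD mulrC; apply: ler_pM => //.
      rewrite -[leLHS]expr1 ler_weXn2l ?ler1n// expn_gt0//.
    rewrite -exprM; apply: le_trans (two_pow_le_expR _) _.
    by rewrite ler_expR !natrM natrX; lra.
  rewrite expRN ler_pdivrMr ?expR_gt0// mul1r (le_trans pow)// ler_expR//.
apply: (@le_trans _ _ ((k%:R * A) ^+ k)); last first.
  by rewrite [1 + _]addrC -addrA lerDl addr_ge0.
apply: le_trans (pow_expRN_le k0 A1 T0).
rewrite ler_wpM2l// ler_expR lerN2.
rewrite ler_pdivlMr ?mulr_gt0// ; have W2 : W <= 2 * (6 * s * M / rho) by lra.
have A0 : 0 < A := lt_le_trans ltr01 A1.
have c0 : 0 <= 2 * (h%:R * rho / A) by rewrite mulr_ge0// divr_ge0// ltW.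
have := ler_wpM2l c0 W2.
have -> : 2 * (h%:R * rho / A) * (2 * (6 * s * M / rho)) = h%:R.
  by rewrite /A; field; rewrite !lt0r_neq0 ?ltr_pwDl.
lra.
Qed.

End Moments.

(** * From gaps to empty windows *)

Section PowerSums.
Local Open Scope nat_scope.

Lemma expnS_diff n k : n.+1 ^ k.+1 <= n ^ k.+1 + k.+1 * n.+1 ^ k.
Proof.
elim: k => [|k IH]; first by rewrite !expn1 expn0 muln1 addn1.
rewrite expnS; apply: leq_trans (leq_mul (leqnn n.+1) IH) _.
have : n ^ k.+1 <= n.+1 ^ k.+1 by rewrite leq_exp2r.
have E (x y : nat) : n.+1 * (x + k.+1 * y) = n * x + (x + k.+1 * (n.+1 * y)) by lia.
by rewrite E -!expnS => le_n; rewrite leq_add2l [k.+2 * _]mulSn leq_add2r.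
Qed.

Lemma exp_leq_sum_pow k g : g ^ k.+1 <= k.+1 * \sum_(h < g) h.+1 ^ k.
Proof.
elim: g => [|g IH]; first by rewrite exp0n.
rewrite big_ord_recr /= mulnDr; apply: leq_trans (expnS_diff g k) _.
by rewrite leq_add2r.
Qed.

(** A discrete double integration of [h ^ k]. The kernel [g - h] is the number of empty windows of
    length [h] inside a gap of length [g]. *)
Lemma exp_leq_sum_weights k g :
  g ^ k.+2 <= k.+2 * (k.+1 * \sum_(h < g) h.+1 ^ k * (g - h)).
Proof.
elim: g => [|g IH]; first by rewrite exp0n.
have -> : \sum_(h < g.+1) h.+1 ^ k * (g.+1 - h) =
    \sum_(h < g) h.+1 ^ k * (g - h) + \sum_(h < g.+1) h.+1 ^ k.
  rewrite [X in _ = X + _](_ : _ = \sum_(h < g.+1) h.+1 ^ k * (g - h)).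
    by rewrite -big_split; apply: eq_bigr => h _; rewrite subSn ?mulnS 1?addnC// -ltnS.
  by rewrite big_ord_recr /= subnn muln0 addn0.
rewrite (mulnDr k.+1) (mulnDr k.+2); apply: leq_trans (expnS_diff g k.+1) _.
by apply: leq_add => //; apply: leq_mul => //; apply: exp_leq_sum_pow.
Qed.

End PowerSums.

Section Gaps.
Local Open Scope nat_scope.
Variables (D : {fset int}) (q : nat) (a : nat -> nat).
Hypothesis aP : increasing_enumeration (reduced_tuple D q) a.

Lemma enum_lt i j : 0 < i -> i < j -> a i < a j. Proof. exact: aP.1. Qed.

Lemma enum_leq i j : 0 < i -> i <= j -> a i <= a j.
Proof. by move=> i0; rewrite leq_eqVlt => /predU1P[->//|/(enum_lt i0)/ltnW]. Qed.

Lemma enum_good i : 0 < i -> 0 < a i /\ good D q (a i).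
Proof.
move=> i0; have [|ai0 ga] := (aP.2 (a i)).2; first by exists i.
by split=> //; apply/goodP.
Qed.

Lemma enum_surj n : 0 < n -> good D q n -> exists2 i, 0 < i & a i = n.
Proof. by move=> n0 /goodP gn; apply: (aP.2 n).1. Qed.

Lemma enum_gap i n : 0 < i -> a i < n < a i.+1 -> good D q n = false.
Proof.
move=> i0 /andP[an na]; apply/negP => gn.
have [k k0 ak] := enum_surj (leq_ltn_trans (leq0n _) an) gn.
move: an na; rewrite -ak; have [ki|ik] := leqP k i.
  by rewrite ltnNge enum_leq.
by move=> _; rewrite ltnNge enum_leq.
Qed.

Lemma sum_enum_good i : \sum_((a 1).+1 <= n < (a i.+1).+1) good D q n = i.
Proof.
elim: i => [|i IH]; first by rewrite big_geq.
have lt1 : a i.+1 < a i.+2 by apply: enum_lt.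
rewrite (@big_cat_nat _ _ _ (a i.+1).+1)/= ?ltnS ?enum_leq// IH.
rewrite big_nat_recr//= (enum_good (ltn0Sn i.+1)).2 big_nat big1 ?addn1// => n ann.
by rewrite (@enum_gap i.+1).
Qed.

Lemma sum_gaps_leq h k :
  \sum_(1 <= i < k.+1) (a i.+1 - a i - h) <=
  \sum_((a 1).+1 <= n < (a k.+1).+1) (survivors D q n h == 0).
Proof.
elim: k => [|k IH]; first by rewrite !big_geq.
have lt1 : a k.+1 < a k.+2 by apply: enum_lt.
rewrite big_nat_recr//= [leqRHS](@big_cat_nat _ _ _ (a k.+1).+1)/= ?ltnS ?enum_leq//.
apply: leq_add IH _.
(* Truncated subtraction makes short gaps contribute 0. In a long gap, every start from [a k.+1 + 1]
   to [a k.+2 - h] gives an empty window. *)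
have [short|long] := leqP (a k.+2 - a k.+1) h.
  by move: short; rewrite -subn_eq0 => /eqP ->.
rewrite (@big_cat_nat _ _ _ (a k.+2 - h).+1)/=; [|lia|lia].
apply: leq_trans (leq_addr _ _).
rewrite [leqRHS](_ : _ = \sum_((a k.+1).+1 <= n < (a k.+2 - h).+1) 1).
  by rewrite sum_nat_const_nat muln1; lia.
apply: eq_big_nat => n /andP[an na].
rewrite (_ : survivors D q n h = 0) ?eqxx// /survivors big1// => m _.
by rewrite (@enum_gap k.+1)//; have := ltn_ord m; lia.
Qed.

Hypotheses (D_adm : admissible D) (q0 : 0 < q) (sqf : squarefree q).

Lemma sum_good_phiD (R : realType) : \sum_(n < q) good D q n = phiD D q.
Proof.
apply/eqP; rewrite -(eqr_nat R) (density_full R D_adm q0 sqf (ltnSn q)).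
have := sum_good_modulus R q D_adm q.+1.
by rewrite (modulus_full q0 sqf (ltnSn q)) => ->.
Qed.

(** By periodicity [a 1 + q] occurs in the sequence; counting good integers in one period after
    [a 1] determines its index. *)
Lemma enum_period (R : realType) : a (phiD D q).+1 = a 1 + q.
Proof.
have [a1 g1] := enum_good (ltn0Sn 0).
have [[//|j] _ aj] : exists2 i, 0 < i & a i = a 1 + q.
  by apply: enum_surj; rewrite ?ltn_addr// good_period.
rewrite -aj; congr (a _.+1); rewrite -(sum_good_phiD R) -[RHS](sum_enum_good j) aj.
rewrite -addSn (@big_periodic_shift _ _ addn q _ (fun n => good D q n))//.
by move=> n; rewrite good_period.
Qed.

Lemma sum_gaps_gap_starts (R : realType) h :
  \sum_(1 <= i < (phiD D q).+1) (a i.+1 - a i - h) <= gap_starts D q h.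
Proof.
apply: leq_trans (sum_gaps_leq _ _) _; rewrite (enum_period R) -addSn.
rewrite (@big_periodic_shift _ _ addn q _ (fun n => survivors D q n h == 0 : nat))//.
move=> n; congr (nat_of_bool (_ == 0)); apply: eq_bigr => m _.
by rewrite addnAC good_period.
Qed.

(** Every gap is at most [a (phiD D q).+1]; with this common range for [h] the two sums can be
    exchanged. *)
Lemma sum_gap_powers (R : realType) k :
  \sum_(1 <= i < (phiD D q).+1) (a i.+1 - a i) ^ k.+2 <=
  k.+2 * (k.+1 * \sum_(h < a (phiD D q).+1) h.+1 ^ k * gap_starts D q h).
Proof.
set B := a _; set N := phiD D q.
apply: (@leq_trans (\sum_(1 <= i < N.+1)
   k.+2 * (k.+1 * \sum_(h < B) h.+1 ^ k * (a i.+1 - a i - h)))).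
  rewrite big_nat_cond [leqRHS]big_nat_cond; apply: leq_sum => i /andP[/andP[i0 iN] _].
  apply: leq_trans (exp_leq_sum_weights _ _) _; rewrite !leq_mul//.
  apply: (@leq_sum_ord _ _ (fun h => h.+1 ^ k * (a i.+1 - a i - h))).
  by rewrite (leq_trans (leq_subr _ _))// enum_leq.
rewrite -!big_distrr /= !leq_mul// exchange_big /=; apply: leq_sum => h _.
by rewrite -big_distrr leq_mul// sum_gaps_gap_starts.
Qed.

End Gaps.

(** * Comparison with Euler's function *)

Section DensityTotient.
Local Open Scope ring_scope.
Variables (R : realType) (D : {fset int}).
Hypothesis D_adm : admissible D.

(** Telescopes [1 / p ^ 2 <= 1 / (p - 1) - 1 / p]. *)
Lemma sum_inv_sqr_le (m n : nat) : (0 < m)%N ->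
  \sum_(m.+1 <= p < n) (p%:R ^+ 2)^-1 <= m%:R^-1 :> R.
Proof.
move=> m0; have mR : (0 : R) < m%:R by rewrite ltr0n.
have [nm|mn] := leqP n m.+1; first by rewrite big_geq// invr_ge0.
have le1 : \sum_(m.+1 <= p < n) (p%:R ^+ 2)^-1 <=
    \sum_(m.+1 <= p < n) - (p%:R^-1 - p.-1%:R^-1) :> R.
  rewrite big_nat_cond [leRHS]big_nat_cond; apply: ler_sum => p /andP[/andP[mp _] _].
  case: p mp => // p; rewrite ltnS => mp /=.
  have p0 : (0 : R) < p%:R by rewrite ltr0n (leq_trans m0).
  have p1 : (0 : R) < p.+1%:R by rewrite ltr0n.
  rewrite opprB -[p.+1]addn1 natrD in p1 *.
  have -> : p%:R^-1 - (p%:R + 1)^-1 = (p%:R * (p%:R + 1))^-1 :> R.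
    by field; rewrite !lt0r_neq0.
  rewrite lef_pV2 ?posrE ?mulr_gt0 ?exprn_gt0//; nra.
apply: le_trans le1 _; rewrite big_add1 /= sumrN.
case: n mn => // n; rewrite ltnS => mn /=.
rewrite telescope_sumr ?opprB; last exact: ltnW.
by rewrite lerBlDr lerDl invr_ge0.
Qed.

(* Bernoulli gives (1 - x)^s (1 + s x) <= ((1 - x) (1 + x))^s <= 1 with x = 1 / p. *)
Lemma local_density_ge (p : nat) : prime p ->
  (1 - (#|` D|%:R ^+ 2 / p%:R ^+ 2)) * (1 - p%:R^-1) ^+ #|` D| <=
  1 - (nu p D)%:R / p%:R :> R.
Proof.
move=> pp; set s := #|` D|.
have p0 : (0 : R) < p%:R by rewrite ltr0n prime_gt0.
have p1 : p%:R^-1 <= 1 :> R by rewrite invf_le1// ler1n prime_gt0.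
set x : R := p%:R^-1 in p1 *; have x0 : 0 <= x by rewrite invr_ge0.
have nus : 1 - s%:R * x <= 1 - (nu p D)%:R * x.
  by rewrite lerD2l lerN2 ler_wpM2r// ler_nat nu_le_card.
have sx0 : 0 <= s%:R * x by rewrite mulr_ge0.
have bern n : 1 + n%:R * x <= (1 + x) ^+ n.
  elim: n => [|n IH]; first by rewrite mul0r addr0 expr0.
  rewrite exprSr; have := ler_wpM2r (addr_ge0 ler01 x0) IH; apply: le_trans.
  rewrite -natr1; have : 0 <= n%:R * (x * x) by rewrite !mulr_ge0.
  lra.
have y0 : 0 <= (1 - x) ^+ s by rewrite exprn_ge0// subr_ge0.
have key : (1 - x) ^+ s * (1 + s%:R * x) <= 1.
  apply: le_trans (ler_wpM2l y0 (bern s)) _; rewrite -exprMn.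
  by apply: exprn_ile1; [apply: mulr_ge0|]; nra.
have -> : s%:R ^+ 2 / p%:R ^+ 2 = (s%:R * x) ^+ 2 by rewrite exprMn exprVn.
have -> : 1 - (s%:R * x) ^+ 2 = (1 - s%:R * x) * (1 + s%:R * x) by ring.
have [neg|pos] := lerP (1 - s%:R * x) 0.
  apply: (@le_trans _ _ 0); last by rewrite ltW// local_density_gt0.
  by rewrite -mulrA mulr_le0_ge0// mulr_ge0// addr_ge0.
apply: le_trans nus; rewrite -mulrA [X in _ * X]mulrC -[leRHS]mulr1.
by rewrite ler_wpM2l// ltW.
Qed.

(** Below [Y], admissibility gives [1 - nu_p / p >= 1 / p], a loss bounded in terms of [D]. From [Y]
    on, [local_density_ge] loses only factors [1 - s ^ 2 / p ^ 2], whose product is at least [1 / 2]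
    by the choice of [Y]. *)
Lemma density_totient : exists2 c : R, 0 < c & forall q : nat,
  (0 < q)%N -> squarefree q ->
  c * ((totient q)%:R / q%:R) ^+ #|` D| <= (phiD D q)%:R / q%:R.
Proof.
set s := #|` D|; pose Y := (2 * s.+1 ^ 2).+1.
pose c1 : R := \prod_(0 <= p < Y | prime p) p%:R^-1.
have c10 : 0 < c1 by apply: prodr_gt0 => p pp; rewrite invr_gt0 ltr0n prime_gt0.
exists (c1 / 2); first by rewrite divr_gt0.
move=> q q0 sqf; pose N := (q + Y).+1.
have qN : (q < N)%N by rewrite ltnS leq_addr.
have YN : (Y <= N)%N by rewrite leqW// leq_addl.
have prime_in p : p \in primes q -> prime p by rewrite mem_primes => /andP[].
have q0R : q%:R != 0 :> R by rewrite pnatr_eq0 -lt0n.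
have -> : (phiD D q)%:R / q%:R = density R D q N.
  by rewrite (density_full R D_adm q0 sqf qN) mulrC mulKf.
rewrite (totient_squarefree R q0 sqf qN) -prodrXl /density.
rewrite (@big_cat_nat _ _ _ Y 0 N)//= [leRHS](@big_cat_nat _ _ _ Y 0 N)//=.
have inv_le1 p : prime p -> 0 <= (p%:R^-1 : R) <= 1.
  by move=> pp; rewrite invr_ge0 ler0n invf_le1 ?ltr0n ?ler1n prime_gt0.
have pow01 p : p \in primes q -> 0 <= (1 - p%:R^-1 : R) ^+ s <= 1.
  move=> /prime_in/inv_le1/andP[x0 x1].
  by rewrite exprn_ge0 ?subr_ge0// exprn_ile1 ?subr_ge0// lerBlDr lerDl.
have small : c1 * \prod_(0 <= p < Y | p \in primes q) (1 - p%:R^-1) ^+ s <=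
    \prod_(0 <= p < Y | p \in primes q) (1 - (nu p D)%:R / p%:R) :> R.
  apply: (@le_trans _ _ (\prod_(0 <= p < Y | p \in primes q)
                           (p%:R^-1 * (1 - p%:R^-1) ^+ s))).
    rewrite big_split /= ler_wpM2r//.
      by apply: prodr_ge0 => p /pow01/andP[].
    rewrite /c1 big_mkcond [leRHS]big_mkcond /=; apply: ler_prod => p _.
    have [/prime_in pp|_] := boolP (p \in primes q).
      by rewrite pp; have /andP[-> _] := inv_le1 p pp; rewrite lexx.
    by case: ifP => [/inv_le1//|_]; rewrite ler01 lexx.
  apply: ler_prod => p pq; have pp := prime_in p pq.
  have p0 : (0 : R) < p%:R by rewrite ltr0n prime_gt0.
  have /andP[y0 y1] := pow01 p pq; have /andP[x0 _] := inv_le1 p pp.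
  rewrite mulr_ge0//=; apply: (@le_trans _ _ p%:R^-1); first by rewrite ler_piMr.
  rewrite -(ler_pM2r p0) mulVf ?lt0r_neq0// mulrBl mul1r divfK ?lt0r_neq0//.
  by rewrite lerBrDr nat1r ler_nat; apply: D_adm.
have large : 1 / 2 * \prod_(Y <= p < N | p \in primes q) (1 - p%:R^-1) ^+ s <=
    \prod_(Y <= p < N | p \in primes q) (1 - (nu p D)%:R / p%:R) :> R.
  pose x (p : nat) : R := s%:R ^+ 2 / p%:R ^+ 2.
  have x01 p : (Y <= p)%N -> 0 <= x p <= 1.
    move=> Yp; have sp : (s <= p)%N by apply: leq_trans Yp; rewrite /Y; nia.
    have p0 : (0 < p)%N by apply: leq_trans Yp.
    rewrite divr_ge0 ?exprn_ge0//= ler_pdivrMr ?exprn_gt0 ?ltr0n// mul1r.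
    by apply: lerXn2r; rewrite ?nnegrE ?ler_nat.
  apply: (@le_trans _ _ (\prod_(Y <= p < N | p \in primes q)
                           ((1 - x p) * (1 - p%:R^-1) ^+ s))); last first.
    rewrite big_nat_cond [leRHS]big_nat_cond.
    apply: ler_prod => p /andP[/andP[Yp _] pq]; have /andP[x0 x1] := x01 p Yp.
    have /andP[y0 _] := pow01 p pq.
    by rewrite mulr_ge0 ?subr_ge0//=; apply/local_density_ge/prime_in.
  rewrite big_split /= ler_wpM2r//; first by apply: prodr_ge0 => p /pow01/andP[].
  rewrite big_nat_cond.
  have x01' p : (Y <= p < N)%N && (p \in primes q) -> 0 <= x p <= 1.
    by move=> /andP[/andP[Yp _] _]; exact: x01.
  apply: le_trans (one_minus_sum_le_prod Y N x01').
  have s2 : (0 : R) < (2 * s.+1 ^ 2)%:R by rewrite ltr0n muln_gt0 expn_gt0.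
  have Z0 : (0 < 2 * s.+1 ^ 2)%N by rewrite muln_gt0 expn_gt0.
  have le1 : \sum_(Y <= p < N | (Y <= p < N)%N && (p \in primes q)) x p <=
      s%:R ^+ 2 * \sum_(Y <= p < N) (p%:R ^+ 2)^-1.
    rewrite mulr_sumr big_mkcond; apply: ler_sum => p _.
    by case: ifP => // _; rewrite divr_ge0 ?exprn_ge0.
  have := ler_wpM2l (exprn_ge0 2 (ler0n R s)) (sum_inv_sqr_le N Z0).
  have : s%:R ^+ 2 * (2 * s.+1 ^ 2)%:R^-1 <= 1 / 2 :> R.
    rewrite ler_pdivrMr// natrM natrX -[s.+1]addn1 natrD.
    have := ler0n R s; nra.
  move=> half tail; rewrite lerBrDr -lerBrDl; apply: le_trans le1 _.
  by apply: le_trans tail _; apply: le_trans half _; lra.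
apply: le_trans (ler_pM _ _ small large).
- by rewrite le_eqVlt; apply/orP; left; apply/eqP; field.
- by rewrite mulr_ge0 ?(ltW c10)//; apply: prodr_ge0 => p /pow01/andP[].
- by rewrite mulr_ge0 ?divr_ge0//; apply: prodr_ge0 => p /pow01/andP[].
Qed.

End DensityTotient.

(** * Gap moments *)

Section GapMoments.
Local Open Scope ring_scope.
Variables (R : realType) (D : {fset int}).
Hypothesis D_adm : admissible D.

(** With [x = 1 + h * rho], the bound [x + rho <= 2 * x] compares [1 / x ^ 2] with a telescoping
    difference, uniformly in [B]. *)
Lemma sum_inv_sqr_affine_le (rho : R) (B : nat) : 0 < rho -> rho <= 1 ->
  \sum_(h < B) (1 + h%:R * rho) ^- 2 <= 2 / rho.
Proof.
move=> r0 r1.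
have term (h : nat) : (1 + h%:R * rho) ^- 2 <=
    2 / rho * ((1 + h%:R * rho)^-1 - (1 + h.+1%:R * rho)^-1).
  rewrite -[h.+1]addn1 natrD; set x := 1 + h%:R * rho.
  have x1 : 1 <= x by rewrite lerDl mulr_ge0// ltW.
  have -> : 1 + (h%:R + 1) * rho = x + rho by rewrite /x; ring.
  have x0 : 0 < x by lra.
  have xr0 : 0 < x + rho by lra.
  have -> : 2 / rho * (x^-1 - (x + rho)^-1) = 2 / (x * (x + rho)).
    by field; rewrite !lt0r_neq0.
  rewrite ler_pdivlMr ?mulr_gt0// mulrC ler_pdivrMr ?exprn_gt0//; nra.
apply: (@le_trans _ _ (\sum_(h < B)
  (2 / rho * ((1 + h%:R * rho)^-1 - (1 + h.+1%:R * rho)^-1)))).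
  by apply: ler_sum => h _; exact: term.
rewrite -mulr_sumr.
rewrite -(big_mkord xpredT (fun h => (1 + h%:R * rho)^-1 - (1 + h.+1%:R * rho)^-1)).
rewrite -[leRHS]mulr1 ler_wpM2l ?divr_ge0 ?(ltW r0)//.
rewrite (@telescope_sumr_eq _ 0 B (fun h => - (1 + h%:R * rho)^-1))//; last first.
  by move=> h _; rewrite opprK addrC.
rewrite mul0r addr0 invr1 opprK addrC lerBlDr lerDl invr_ge0.
by rewrite addr_ge0// mulr_ge0// ltW.
Qed.

Lemma sum_gap_powers_le (k : nat) : exists2 C : R, 0 < C &
  forall (q : nat) (a : nat -> nat), (0 < q)%N -> squarefree q ->
    increasing_enumeration (reduced_tuple D q) a ->
    ((phiD D q)%:R / q%:R) ^+ k.+2 *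
      (\sum_(1 <= i < (phiD D q).+1) (a i.+1 - a i) ^ k.+2)%:R <= C * (phiD D q)%:R.
Proof.
(* Of the exponent [k + 2], [k] powers absorb the weight [h.+1 ^ k] and two make the sum over [h]
   converge. *)
have [C C0 HC] := gap_starts_moment R D_adm (ltn0Sn k.+1).
exists (k.+2%:R * k.+1%:R * (2 * C)); first by rewrite !mulr_gt0// ltr0n.
move=> q a q0 sqf aP; have q0R : (0 : R) < q%:R by rewrite ltr0n.
set N := phiD D q; set rho := N%:R / q%:R.
have rhoE : rho = density R D q q.+1.
  by rewrite /rho (density_full R D_adm q0 sqf (ltnSn q)) mulrC mulKf ?lt0r_neq0.
have r0 : 0 < rho by rewrite rhoE density_gt0.
have r1 : rho <= 1 by rewrite rhoE density_le1.
have NE : N%:R = q%:R * rho by rewrite /rho mulrCA divff ?mulr1 ?lt0r_neq0.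
set B := a N.+1.
have weight (h : nat) : rho ^+ k * (h.+1 ^ k * gap_starts D q h)%:R <=
    C * q%:R * (1 + h%:R * rho) ^- 2.
  have x0 : 0 < 1 + h%:R * rho by rewrite ltr_pwDl// mulr_ge0// ltW.
  rewrite ler_pdivlMr ?exprn_gt0//; apply: le_trans (HC q h q0 sqf).
  rewrite -/N -/rho natrM natrX mulrA -exprMn.
  have le_x : (rho * h.+1%:R) ^+ k <= (1 + h%:R * rho) ^+ k.
    have le1 : rho * h.+1%:R <= 1 + h%:R * rho by rewrite -[h.+1]addn1 natrD; lra.
    by apply: lerXn2r; rewrite // nnegrE ?(ltW x0)// mulr_ge0// ltW.
  have g0 : 0 <= (gap_starts D q h)%:R * (1 + h%:R * rho) ^+ 2 :> R.
    by rewrite mulr_ge0// exprn_ge0// ltW.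
  have := ler_wpM2l g0 le_x.
  have -> : (1 + h%:R * rho) ^+ k.+2 = (1 + h%:R * rho) ^+ k * (1 + h%:R * rho) ^+ 2.
    by rewrite -exprD addn2.
  lra.
have sum_le : rho ^+ k * (\sum_(h < B) h.+1 ^ k * gap_starts D q h)%:R <=
    C * q%:R * (2 / rho).
  rewrite natr_sum mulr_sumr; apply: (@le_trans _ _
    (\sum_(h < B) (C * q%:R * (1 + h%:R * rho) ^- 2))).
    by apply: ler_sum => h _; exact: weight.
  by rewrite -mulr_sumr ler_wpM2l ?sum_inv_sqr_affine_le// mulr_ge0// ltW.
have := sum_gap_powers aP D_adm q0 sqf R k; rewrite -/N -/B -(ler_nat R) !natrM.
set G := (\sum_(1 <= i < _) _)%:R => G_le.
have rk : 0 <= rho ^+ k.+2 by rewrite exprn_ge0// ltW.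
apply: le_trans (ler_wpM2l rk G_le) _; rewrite NE -addn2 exprD.
have c0 : 0 <= k.+2%:R * k.+1%:R * rho ^+ 2.
  by apply: mulr_ge0; [apply: mulr_ge0|apply: exprn_ge0; exact: ltW].
have := ler_wpM2l c0 sum_le.
have -> : k.+2%:R * k.+1%:R * rho ^+ 2 * (C * q%:R * (2 / rho)) =
  k.+2%:R * k.+1%:R * (2 * C) * (q%:R * rho) by field; rewrite lt0r_neq0.
by rewrite -addn2; lra.
Qed.

(** Reduces real exponents to integral ones, according to whether [x <= 1]. *)
Lemma powR_le_1D_exp (x lambda : R) (k : nat) : 0 <= x -> 0 <= lambda -> lambda <= k%:R ->
  x `^ lambda <= 1 + x ^+ k.
Proof.
move=> x0 l0 lk; have [x1|x1] := lerP x 1.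
  apply: (@le_trans _ _ (1 `^ lambda)); first by apply: ge0_ler_powR; rewrite ?nnegrE.
  by rewrite powR1 lerDl exprn_ge0.
rewrite -powR_mulrn//; apply: (@le_trans _ _ (x `^ k%:R)); last by rewrite lerDr.
exact: ler_powR (ltW x1) _ _ lk.
Qed.

End GapMoments.

Theorem theorem0p1 (R : realType) (D : {fset int}) (lambda : R)
  (D_adm : admissible D) (lambda_gt0 : 0 < lambda) :
  exists2 C : R, 0 < C &
    forall (q : nat) (a : nat -> nat),
      (0 < q)%N -> squarefree q ->
      increasing_enumeration (reduced_tuple D q) a ->
      gap_moment a lambda (phiD D q) <=
        C * ((phiD D q)%:R *
             ((totient q)%:R / q%:R) `^ (- ((#|` D|)%:R * lambda))).
Proof.
have l0 := ltW lambda_gt0.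
pose k := Num.truncn lambda.
have lk : lambda <= k.+2%:R by rewrite ltW// (lt_le_trans (truncnS_gt _))// ler_nat.
have [C C0 HC] := sum_gap_powers_le R D_adm k.
have [c c0 Hc] := density_totient R D_adm.
exists ((1 + C) * c `^ (- lambda)); first by rewrite mulr_gt0 ?powR_gt0// addr_gt0.
move=> q a q0 sqf aP; have q0R : (0 : R) < q%:R by rewrite ltr0n.
have {}HC := HC q a q0 sqf aP; have {}Hc := Hc q q0 sqf.
set N := phiD D q in HC Hc *; set P := _ / _ in Hc *; set rho := N%:R / q%:R in HC Hc.
have P0 : 0 < P by rewrite divr_gt0// ltr0n totient_gt0.
have r0 : 0 < rho by apply: lt_le_trans Hc; rewrite mulr_gt0// exprn_gt0.
have rho_le : rho `^ (- lambda) <= c `^ (- lambda) * P `^ (- (#|` D|%:R * lambda)).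
  rewrite !powRN powRrM powR_mulrn ?(ltW P0)// -invfM.
  rewrite -powRM ?exprn_ge0 ?(ltW c0) ?(ltW P0)//.
  rewrite lef_pV2 ?posrE ?powR_gt0// ?mulr_gt0 ?exprn_gt0//.
  apply: ge0_ler_powR => //; rewrite nnegrE ltW//.
  by rewrite mulr_gt0// exprn_gt0.
(* [powR_le_1D_exp] is applied to the gaps rescaled by their mean [1 / rho]; its summand 1
   contributes [N] and its power at most [C * N]. *)
have moment : gap_moment a lambda N <= rho `^ (- lambda) * ((1 + C) * N%:R).
  have term i : (1 <= i < N.+1)%N -> ((a i.+1)%:R - (a i)%:R) `^ lambda <=
      rho `^ (- lambda) * (1 + rho ^+ k.+2 * ((a i.+1 - a i) ^ k.+2)%N%:R) :> R.
    move=> /andP[i0 _]; rewrite -natrB; last by rewrite ltnW// (enum_lt aP).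
    set g := (a i.+1 - a i)%N.
    have x0 : 0 <= rho * g%:R by rewrite mulr_ge0// ltW.
    have := powR_le_1D_exp x0 l0 lk; rewrite powRM ?(ltW r0)// exprMn -natrX => le_x.
    by rewrite powRN mulrC ler_pdivlMr ?powR_gt0// mulrC.
  rewrite /gap_moment big_nat_cond.
  apply: (@le_trans _ _ (\sum_(1 <= i < N.+1)
     (rho `^ (- lambda) * (1 + rho ^+ k.+2 * ((a i.+1 - a i) ^ k.+2)%N%:R)))).
    rewrite [leRHS]big_nat_cond; apply: ler_sum => i /andP[iN _]; exact: term.
  rewrite -mulr_sumr ler_wpM2l ?powR_ge0// big_split /= -mulr_sumr -natr_sum.
  rewrite sumr_const_nat subn1 /= mulrDl mul1r lerD2l.
  exact: HC.
apply: le_trans moment _.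
have CN : 0 <= (1 + C) * N%:R by rewrite mulr_ge0// addr_ge0// ltW.
have := ler_wpM2r CN rho_le; lra.
Qed.
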